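(* Let $m,n>1$ be integers. A cyclic $C_4$-factorization of $K_{m\times n}$ exists if and only if one of the following cases occurs: (a) $m$ and $n$ are both even; (b) $m$ is odd, $n\equiv 0\pmod 4$, and $(m,n)$ is not of the form $(p^\alpha,4)$ with $p$ a prime and $\alpha\geq 1$ an integer.
   Context: $K_{m\times n}$ denotes the complete multipartite graph with $m$ parts, each of cardinality $n$. Its vertex set is always taken to be $\mathbb{Z}_{mn}$, and its parts are the cosets of the subgroup $m\mathbb{Z}_{mn}$ (the subgroup of index $m$); thus distinct $x,y\in\mathbb{Z}_{mn}$ are adjacent iff $x-y\notin m\mathbb{Z}_{mn}$. A $2$-factor of a graph is a set of cycles (subgraphs) whose vertex sets partition the vertex set of the graph. A $2$-factorization is a set $\mathcal{F}$ of $2$-factors such that every edge of the graph appears in exactly one member of $\mathcal{F}$. A $C_\ell$-factorization is a $2$-factorization in which every cycle of every $2$-factor has length $\ell$. A $2$-factorization $\mathcal{F}$ of $K_{m\times n}$ is cyclic if $F+g\in\mathcal{F}$ for every $F\in\mathcal{F}$ and every $g\in\mathbb{Z}_{mn}$, where $F+g$ is obtained by replacing each vertex $x$ by $x+g$. *)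

(* Defs.v *)
From mathcomp Require Import all_boot all_order all_algebra.
Set Implicit Arguments.
Unset Strict Implicit.
Unset Printing Implicit Defensive.
Import GRing.Theory.

(* A graph is given by its adjacency relation e : rel V.  A cycle is encoded as
   its set of edges C : {set {set V}}, which determines it as a subgraph: its
   vertex set is cover C and its length is #|C|.  Likewise the edges used by a
   2-factor F : {set {set {set V}}} form the set cover F. *)

Section Factorizations.
Variables (V : finType) (e : rel V).

Definition edges : {set {set V}} :=
  [set E | [exists x, exists y, e x y && (E == [set x; y])]].

Definition cycle_edges (c : seq V) : {set {set V}} :=
  [set [set x; next c x] | x in c].

Definition is_cycle (C : {set {set V}}) : Prop :=
  exists c : seq V, [/\ 2 < size c, ucycle e c & C = cycle_edges c].

(* Cardinality one, rather than "partition (cover @: F) setT": the image would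
   identify distinct cycles of F that have the same vertex set. *)
Definition is_2factor (F : {set {set {set V}}}) : Prop :=
  (forall C, C \in F -> is_cycle C) /\
  (forall x : V, #|[set C in F | x \in cover C]| = 1).

Definition is_2factorization (Fs : {set {set {set {set V}}}}) : Prop :=
  (forall F, F \in Fs -> is_2factor F) /\
  (forall E, E \in edges -> #|[set F in Fs | E \in cover F]| = 1).

Definition is_cycle_factorization (l : nat) (Fs : {set {set {set {set V}}}}) :
    Prop :=
  is_2factorization Fs /\ (forall F C, F \in Fs -> C \in F -> #|C| = l).

End Factorizations.

Section Translation.
Variable G : finZmodType.

Definition translate (F : {set {set {set G}}}) (g : G) : {set {set {set G}}} :=
  [set [set [set (x + g)%R | x in E] | E : {set G} in C]
     | C : {set {set G}} in F].

Definition is_cyclic (Fs : {set {set {set {set G}}}}) : Prop :=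
  forall F g, F \in Fs -> translate F g \in Fs.

End Translation.

Definition part_subgroup (m n : nat) : {set 'Z_(m * n)} :=
  [set (x *+ m)%R | x : 'Z_(m * n)].

(* 'Z_(m * n) is the ring of integers modulo m * n only when 1 < m * n.  The
   relation is irreflexive because 0 belongs to part_subgroup m n. *)
Definition Kmn (m n : nat) : rel 'Z_(m * n) :=
  [rel x y | (x - y)%R \notin part_subgroup m n].
Arguments Kmn m n : clear implicits.

(* Main.v *)
(** Write [m * n = 2 * M].  A 4-cycle [(x, x + d, x + M, x + d + M)] uses only the
    differences [+-d, +-d + M], so modulo [M] it behaves like the edge
    [{x, x + d}]; the twisted parallelogram [(x, x + d, x + d + e, x + e + M)] uses
    the differences of two such edges once each, and a coset of the subgroup of
    order 4 uses [M / 2] alone.  If pieces of these kinds have vertex sets covering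
    the integers modulo a divisor [s] of [M] exactly once, their translates by the
    multiples of [s] form a 2-factor whose translates use each difference of the
    pieces exactly once.  Existence thus amounts to distributing the [d] in
    the interval from 1 to [M / 2] not divisible by [m] among such tilings.  An odd
    [d] tiles the integers modulo 2 alone, and the even ones are handled by the
    reflection [j <-> - j] modulo [s], whose pairs have differences [2 j].  For
    [n = 4] and [m = a * b] with [a], [b] coprime, the differences not divisible by
    [b] are treated modulo [2 * b] and the others modulo [2 * a].

    Conversely, counting edges and cycles gives the parity conditions.  When
    [m = p ^ k] and [n = 4], the factor through an edge [{0, x}] with [x] of order
    [p] has fewer than [2 * m] translates, so it is fixed either by [x] or by [m].
    In the first case the cycle through [{0, x}] is fixed by [x], and summing its
    vertices gives [4 * x = 0].  In the second case translation by [m] permutes the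
    [m] cycles of the factor; as [m] is odd it fixes one, whose vertices then lie in
    a single part. *)

From HB Require Import structures.
Require Import Defs.
From mathcomp Require Import all_boot all_order all_algebra.
From mathcomp Require Import zify.
Set Implicit Arguments.
Unset Strict Implicit.
Unset Printing Implicit Defensive.
Import GRing.Theory.

(** * Equivariant edge colourings *)

Definition quad (V : finType) (a b c d : V) : {set {set V}} :=
  [set [set a; b]; [set b; c]; [set c; d]; [set d; a]].

Lemma quad_rot (V : finType) (a b c d : V) : quad a b c d = quad b c d a.
Proof.
by apply/setP=> E; rewrite !inE -!orbA orbC -!orbA.
Qed.

Lemma quad_rev (V : finType) (a b c d : V) : quad a b c d = quad a d c b.
Proof.
apply/setP=> E; rewrite !inE (setUC [set a] [set d]) (setUC [set d] [set c]).
rewrite (setUC [set c] [set b]) (setUC [set b] [set a]).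
by do 4 case: (E == _).
Qed.

Lemma cover_quad (V : finType) (a b c d : V) :
  cover (quad a b c d) = [set a; b; c; d].
Proof.
apply/setP=> x; apply/bigcupP/idP => [[E]|].
  rewrite !inE -!orbA => /or4P[] /eqP->; rewrite !inE;
  by case/orP=> /eqP->; rewrite eqxx ?orbT.
rewrite !inE -!orbA => /or4P[] /eqP->.
- by exists [set a; b]; rewrite !inE eqxx.
- by exists [set b; c]; rewrite !inE eqxx ?orbT.
- by exists [set c; d]; rewrite !inE eqxx ?orbT.
- by exists [set d; a]; rewrite !inE eqxx ?orbT.
Qed.

Lemma quad_cycle_edges (V : finType) (a b c d : V) :
  uniq [:: a; b; c; d] -> cycle_edges [:: a; b; c; d] = quad a b c d.
Proof.
rewrite /= !inE !negb_or => /and4P[/and3P[ab ac ad] /andP[bc bd] cd _].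
have na : next [:: a; b; c; d] a = b by rewrite /= eqxx.
have nb : next [:: a; b; c; d] b = c by rewrite /= eq_sym (negbTE ab) eqxx.
have nc : next [:: a; b; c; d] c = d by rewrite /= !(eq_sym c) (negbTE ac) (negbTE bc) eqxx.
have nd : next [:: a; b; c; d] d = a.
  by rewrite /= !(eq_sym d) (negbTE ad) (negbTE bd) (negbTE cd) eqxx.
apply/setP=> E; apply/imsetP/idP => [[x]|].
  rewrite !inE -!orbA => /or4P[] /eqP-> ->; rewrite ?na ?nb ?nc ?nd eqxx ?orbT //.
rewrite !inE -!orbA => /or4P[] /eqP->.
- by exists a; rewrite ?na // !inE eqxx.
- by exists b; rewrite ?nb // !inE eqxx ?orbT.
- by exists c; rewrite ?nc // !inE eqxx ?orbT.
- by exists d; rewrite ?nd // !inE eqxx ?orbT.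
Qed.

Lemma set2_inj (V : finType) (a b c d : V) :
  [set a; b] = [set c; d] -> (a = c /\ b = d) \/ (a = d /\ b = c).
Proof.
move=> e; have: a \in [set c; d] by rewrite -e !inE eqxx.
have: b \in [set c; d] by rewrite -e !inE eqxx orbT.
have: c \in [set a; b] by rewrite e !inE eqxx.
have: d \in [set a; b] by rewrite e !inE eqxx orbT.
rewrite !inE => /orP[] /eqP hd /orP[] /eqP hc /orP[] /eqP hb /orP[] /eqP ha;
  subst; tauto.
Qed.

Lemma card_quad (V : finType) (a b c d : V) :
  uniq [:: a; b; c; d] -> #|quad a b c d| = 4.
Proof.
rewrite /= !inE !negb_or => /and4P[/and3P[ab ac ad] /andP[bc bd] cd _].
rewrite /quad -!setUA !cardsU1 cards1 !inE !negb_or.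
have ne (x y z t : V) : x != z -> x != t -> [set x; y] != [set z; t].
  by move=> /eqP h1 /eqP h2; apply/eqP=> /set2_inj[[]|[]].
have [ba ca] : b != a /\ c != a by rewrite !(eq_sym _ a).
have e3 : [set a; b] != [set d; a] by rewrite setUC ne.
by rewrite e3 !ne.
Qed.

Section Starter.

(* [D] is the set of differences of the edges.  The half-edge [d] at [x] is the
   edge [{x, x + d}]; [col x d] is its colour, and [nu d] is the other half-edge
   of that colour at [x]. *)
Variables (G : finZmodType) (e : rel G) (D : {pred G}) (K : eqType).
Variables (col : G -> G -> K) (nu : G -> G).
Local Open Scope ring_scope.

Hypothesis eD : forall x y, e x y = (y - x \in D).
Hypothesis D0 : 0 \notin D.
Hypothesis DN : {in D, forall d, - d \in D}.
Hypothesis nuD : {in D, forall d, nu d \in D}.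
Hypothesis nu_neq : {in D, forall d, nu d != d}.
Hypothesis colN : forall x, {in D, forall d, col (x + d) (- d) = col x d}.
Hypothesis col_nu : forall x, {in D, forall d, col x (nu d) = col x d}.
Hypothesis col_eq :
  forall x, {in D &, forall d d', col x d = col x d' -> d' = d \/ d' = nu d}.
Hypothesis nu_square : {in D, forall d, d + nu (- d) = nu d + nu (- nu d)}.
Hypothesis col_onto :
  forall x y, {in D, forall d, exists2 d', d' \in D & col y d' = col x d}.
Hypothesis col_shift : forall x y g, {in D &, forall d d',
  col x d = col y d' -> col (x + g) d = col (y + g) d'}.

(** The paths leaving [x] along [d] and along [nu d], each continued in the same colour, meet at the
    fourth vertex by [nu_square]. *)
Definition base_cycle (x d : G) : {set {set G}} :=
  quad x (x + d) (x + d + nu (- d)) (x + nu d).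

Definition color_class (k : K) : {set {set {set G}}} :=
  [set base_cycle p.1 p.2 | p : G * G & (p.2 \in D) && (col p.1 p.2 == k)].

Definition color_classes : {set {set {set {set G}}}} :=
  [set color_class (col p.1 p.2) | p : G * G & p.2 \in D].

(** Seen from [nu d], the half-edge [d] has the same colour, so by [col_eq] it is [nu d] or
    [nu (nu d)]; the first is excluded. *)
Lemma nuK : {in D, involutive nu}.
Proof.
move=> d dD; have h : col 0 (nu d) = col 0 (nu (nu d)).
  by rewrite !col_nu // nuD.
have := col_eq (nuD dD) dD (col_nu 0 dD).
case=> // h'; move: (nu_neq dD); by rewrite -h' eqxx.
Qed.

Lemma color_classP k C :
  reflect (exists x d, [/\ d \in D, col x d = k & C = base_cycle x d])
    (C \in color_class k).
Proof.
apply: (iffP imsetP) => [[[x d]]|[x [d [dD dk ->]]]].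
  by rewrite inE => /andP[dD /eqP dk] ->; exists x, d.
by exists (x, d); rewrite // inE dD dk eqxx.
Qed.

Lemma base_cycle_nu x d : d \in D -> base_cycle x (nu d) = base_cycle x d.
Proof.
move=> dD; rewrite /base_cycle nuK // [RHS]quad_rev.
by rewrite -!addrA (nu_square dD).
Qed.

Lemma base_cycle_rot x d :
  d \in D -> base_cycle (x + d) (nu (- d)) = base_cycle x d.
Proof.
move=> dD; rewrite /base_cycle nuK ?DN // addrK [RHS]quad_rot.
congr quad; rewrite -!addrA; congr (x + _).
have := nu_square (DN dD); rewrite opprK => <-.
by rewrite addrA subrr add0r.
Qed.

Lemma col_rot x d : d \in D -> col (x + d) (nu (- d)) = col x d.
Proof. by move=> dD; rewrite col_nu ?DN // colN. Qed.

(** Reversal ([base_cycle_nu]) and rotation ([base_cycle_rot]) let any vertex of a base cycle serve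
    as its starting point. *)
Lemma base_cycle_at x d y : d \in D -> y \in cover (base_cycle x d) ->
  exists2 d', d' \in D & col y d' = col x d /\ base_cycle x d = base_cycle y d'.
Proof.
move=> dD; rewrite cover_quad !inE -!orbA.
have rot z c : c \in D -> exists2 d', d' \in D & col (z + c) d' = col z c /\
    base_cycle z c = base_cycle (z + c) d'.
  by move=> cD; exists (nu (- c)); rewrite ?nuD ?DN // col_rot // base_cycle_rot.
case/or4P=> /eqP->; first by exists d.
- exact: rot.
- rewrite -(col_rot x dD) -(base_cycle_rot x dD).
  by apply: rot; rewrite nuD ?DN.
- have [d' d'D [h1 h2]] := rot x (nu d) (nuD dD); exists d' => //.
  by rewrite h1 -h2 col_nu // base_cycle_nu.
Qed.

(** Sides are nonzero because [0] is not in [D], diagonals because [nu] has no fixed point in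
    [D]. *)
Lemma base_cycle_uniq x d : d \in D ->
  uniq [:: x; x + d; x + d + nu (- d); x + nu d].
Proof.
move=> dD; have nz c : c \in D -> c != 0.
  by move=> cD; apply: contraNneq D0 => <-.
have aux (y c : G) : (y == y + c) = (c == 0).
  by rewrite -{1}[y]addr0 (inj_eq (addrI y)) eq_sym.
have fD := nuD (DN dD); have gD := nuD dD; have hD := nuD (DN gD).
rewrite /= !inE !negb_or -!(addrA x).
rewrite !aux (inj_eq (addrI x)) !(nz _ dD) !(nz _ gD) /= andbT.
rewrite andbT; apply/and3P; split.
- by rewrite addrC addr_eq0 nu_neq ?DN.
- by rewrite aux nz //= (inj_eq (addrI x)) eq_sym nu_neq.
- by rewrite (inj_eq (addrI x)) (nu_square dD) eq_sym aux nz.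
Qed.

Lemma base_cycle_is_cycle x d : d \in D -> is_cycle e (base_cycle x d).
Proof.
move=> dD; exists [:: x; x + d; x + d + nu (- d); x + nu d].
split=> //; last by rewrite quad_cycle_edges // base_cycle_uniq.
rewrite /ucycle base_cycle_uniq // andbT /= !eD.
have sub (y c : G) : y + c - y = c by rewrite addrC addKr.
have bus (y c : G) : y - (y + c) = - c by rewrite opprD addrA subrr add0r.
have gD := nuD dD; rewrite !sub dD bus nuD ?DN //=.
by rewrite -(addrA x d) (nu_square dD) addrA bus !DN ?nuD ?DN.
Qed.

Lemma base_cycle_edge x d y c : d \in D -> c \in D ->
  [set y; y + c] \in base_cycle x d -> col y c = col x d.
Proof.
move=> dD cD h.
have [d' d'D [<- E]] : exists2 d', d' \in D &
    col y d' = col x d /\ base_cycle x d = base_cycle y d'.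
  apply: base_cycle_at => //; apply/bigcupP; exists [set y; y + c] => //.
  by rewrite !inE eqxx.
move: h; rewrite {}E => h.
suff: c = d' \/ c = nu d' by case=> ->; rewrite ?col_nu.
have := base_cycle_uniq y d'D; move: h.
rewrite !inE -!orbA /= !inE !negb_or => h /and4P[/and3P[n1 n2 n3] _ _ _].
case/or4P: h => /eqP/set2_inj[[h1 h2]|[h1 h2]].
- by left; apply: (addrI y).
- by move: n1; rewrite -h1 eqxx.
- by move: n1; rewrite -h1 eqxx.
- by move: n2; rewrite -h1 eqxx.
- by move: n2; rewrite -h1 eqxx.
- by move: n3; rewrite -h1 eqxx.
- by move: n3; rewrite -h1 eqxx.
- by right; apply: (addrI y).
Qed.

Lemma color_class_edge x d y c : d \in D -> c \in D ->
  ([set y; y + c] \in cover (color_class (col x d))) = (col y c == col x d).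
Proof.
move=> dD cD; apply/bigcupP/eqP => [[C /color_classP[z [b [bD zb ->]]]]|h].
  by rewrite -zb; apply: base_cycle_edge.
exists (base_cycle y c); last by rewrite !inE eqxx.
by apply/color_classP; exists y, c.
Qed.

(** At a vertex [y] the colour occurs by [col_onto], and by [col_eq] only on two half-edges [c] and
    [nu c], which start the same cycle. *)
Lemma color_class_2factor x d : d \in D -> is_2factor e (color_class (col x d)).
Proof.
move=> dD; split=> [C /color_classP[y [c [cD _ ->]]]|y].
  exact: base_cycle_is_cycle.
have [c cD hc] := col_onto x y dD.
apply/eqP/cards1P; exists (base_cycle y c); apply/setP=> C; rewrite !inE.
apply/andP/eqP => [[/color_classP[z [b [bD zb ->]]] yC]|->]; last first.
  split; first by apply/color_classP; exists y, c.
  by rewrite cover_quad !inE eqxx.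
have [b' b'D [h ->]] := base_cycle_at bD yC.
have [|-> //|->] := @col_eq y c b' cD b'D; first by rewrite hc h zb.
by rewrite base_cycle_nu.
Qed.

Lemma color_classes_factorization : is_cycle_factorization e 4 color_classes.
Proof.
split; last first.
  move=> F C /imsetP[[x d]]; rewrite inE /= => dD -> /color_classP[y [c [cD _ ->]]].
  by rewrite card_quad // base_cycle_uniq.
split=> [F /imsetP[[x d]]|E].
  by rewrite inE /= => dD ->; apply: color_class_2factor.
rewrite inE => /existsP[x /existsP[y /andP[]]]; rewrite eD => dD /eqP->.
have -> : y = x + (y - x) by rewrite addrC subrK.
move: (y - x) dD => d dD {y}.
apply/eqP/cards1P; exists (color_class (col x d)); apply/setP=> F; rewrite !inE.
apply/andP/eqP => [[/imsetP[[y c]]]|->].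
  by rewrite inE /= => cD ->; rewrite color_class_edge // => /eqP->.
rewrite color_class_edge //; split=> //.
by apply/imsetP; exists (x, d); rewrite // inE.
Qed.

Lemma translate_quad (g a b c d : G) :
  [set [set (x + g)%R | x in E] | E : {set G} in quad a b c d] =
  quad (a + g) (b + g) (c + g) (d + g).
Proof. by rewrite !imsetU !imset_set1 !imsetU1 !imset_set1. Qed.

Lemma color_classes_cyclic : is_cyclic color_classes.
Proof.
move=> F g /imsetP[[x d]]; rewrite inE /= => dD ->.
suff -> : translate (color_class (col x d)) g = color_class (col (x + g) d).
  by apply/imsetP; exists (x + g, d); rewrite // inE.
have sh y c : [set [set (x + g)%R | x in E] | E : {set G} in base_cycle y c] =
    base_cycle (y + g) c.
  rewrite translate_quad (addrAC y (nu c)) (addrAC y c).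
  by rewrite (addrAC (y + c)) (addrAC y c).
apply/setP=> C; apply/imsetP/color_classP => [[B /color_classP]|].
  case=> y [c [cD h ->]] ->; exists (y + g), c; split=> //; exact: col_shift.
case=> y [c [cD h ->]]; exists (base_cycle (y - g) c); last by rewrite sh subrK.
apply/color_classP; exists (y - g), c; split=> //.
by rewrite (col_shift (- g) cD dD h) addrK.
Qed.

End Starter.

(** * Tiles *)

(* In a group of order [2 * M], [Edge x d] stands for the 4-cycle
   [(x, x + d, x + M, x + d + M)], [Para x d e] for [(x, x + d, x + d + e, x + e + M)]
   and [Loop x] for the coset of [x] modulo the subgroup of order 4. *)
Inductive piece := Edge of nat & nat | Para of nat & nat & nat | Loop of nat.

Definition code_piece (p : piece) : nat * nat + (nat * nat * nat + nat) :=
  match p with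
  | Edge x d => inl (x, d)
  | Para x d e => inr (inl (x, d, e))
  | Loop x => inr (inr x)
  end.

Definition decode_piece (c : nat * nat + (nat * nat * nat + nat)) : piece :=
  match c with
  | inl (x, d) => Edge x d
  | inr (inl (x, d, e)) => Para x d e
  | inr (inr x) => Loop x
  end.

Lemma code_pieceK : cancel code_piece decode_piece. Proof. by case. Qed.

HB.instance Definition _ := Equality.copy piece (can_type code_pieceK).

Definition verts (p : piece) : seq nat :=
  match p with
  | Edge x d => [:: x; x + d]
  | Para x d e => [:: x; x + d; x + d + e; x + e]
  | Loop x => [:: x]
  end.

Definition diffs (M : nat) (p : piece) : seq nat :=
  match p with
  | Edge x d => [:: d]
  | Para x d e => [:: d; e]
  | Loop x => [:: M./2]
  end.

Definition piece_ok (M s : nat) (p : piece) : bool :=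
  match p with
  | Edge x d => (0 < d) && (d.*2 < M)
  | Para x d e => [&& 0 < d, d.*2 < M, 0 < e & e.*2 < M]
  | Loop x => s %| M./2
  end.

Definition tile_ok (M : nat) (t : nat * seq piece) : bool :=
  [&& t.1 %| M, all (piece_ok M t.1) t.2 &
      perm_eq [seq v %% t.1 | v <- flatten (map verts t.2)] (iota 0 t.1)].

Definition tiles_diffs (M : nat) (T : seq (nat * seq piece)) : seq nat :=
  flatten [seq flatten [seq diffs M p | p <- t.2] | t <- T].

(** Modulo [2 * M], the residues [+-d] and [+-d + M] are distinct and are all those congruent to
    [+-d] modulo [M]; [minn r (M - r)] is the representative up to sign that is at most [M / 2]. *)
Lemma half_count_nat M q r d : 0 < d -> d.*2 < M -> 0 < r -> r < M -> q < 2 ->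
  (q * M + r == d) + (q * M + r == d + M) + (q * M + r == M.*2 - d) +
    (q * M + r == M - d) = (d == minn r (M - r)).
Proof.
move=> d0 dM r0 rM q2.
have key : (d == r) + (d == M - r) = (d == minn r (M - r)) :> nat.
  rewrite /minn; case: ifP => h; case: (d =P r) => h1; case: (d =P M - r) => h2 //; lia.
have eqb (a b c e : nat) : (a = b <-> c = e) -> (a == b) = (c == e).
  by move=> h; apply/eqP/eqP => /h.
have nb (a b : nat) : a <> b -> (a == b) = false by move=> /eqP/negbTE.
rewrite -key; have [->|->] : q = 0 \/ q = 1 by lia.
  rewrite mul0n add0n (nb r (d + M)); last lia. rewrite (nb r (M.*2 - d)); last lia.
  rewrite (eqb r d d r); last lia. rewrite (eqb r (M - d) d (M - r)); last lia.
  by rewrite !addn0.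
rewrite mul1n (nb _ d); last lia. rewrite (nb _ (M - d)); last lia.
rewrite (eqb _ (d + M) d r); last lia. rewrite (eqb _ (M.*2 - d) d (M - r)); last lia.
by rewrite add0n addn0.
Qed.

Lemma orb_addn (a b : bool) : ~~ (a && b) -> (a || b) = a + b :> nat.
Proof. by case: a; case: b. Qed.

Lemma edge_half_count M z d : 0 < d -> d.*2 < M ->
  ((z == d) || (z == d + M)) + ((z == M.*2 - d) || (z == M - d)) =
  (z == d) + (z == d + M) + (z == M.*2 - d) + (z == M - d).
Proof.
move=> d0 dM; rewrite !orb_addn ?addnA //;
  by apply/negP=> /andP[/eqP h1 /eqP h2]; lia.
Qed.

(** The left side runs through the four corners of a [Para]; the right side regroups their eight
    half-edges as the four of [d] and the four of [e]. *)
Lemma para_half_count M z d e : 0 < d -> d.*2 < M -> 0 < e -> e.*2 < M ->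
  ((z == d) || (z == e + M)) + (((z == M.*2 - d) || (z == e)) +
    (((z == M.*2 - e) || (z == M - d)) + ((z == d + M) || (z == M - e)))) =
  (z == d) + (z == d + M) + (z == M.*2 - d) + (z == M - d) +
  ((z == e) + (z == e + M) + (z == M.*2 - e) + (z == M - e)).
Proof.
move=> d0 dM e0 eM; rewrite !orb_addn.
  by move: (z == d) (z == e) => a b; lia.
all: by apply/negP=> /andP[/eqP h1 /eqP h2]; lia.
Qed.

(** [M / 2] and [M / 2 + M] are opposite modulo [2 * M], so this difference has two half-edges
    instead of four. *)
Lemma loop_half_count M q r : ~~ odd M -> r < M -> q < 2 ->
  ((q * M + r == M./2) || (q * M + r == M./2 + M)) = (M./2 == minn r (M - r)).
Proof.
move=> Me rM q2.
have -> : (M./2 == minn r (M - r)) = (r == M./2).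
  by apply/eqP/eqP; rewrite /minn; case: ifP => h h'; lia.
have [->|->] : q = 0 \/ q = 1 by lia.
  rewrite mul0n add0n orbC; case: eqP => // h; lia.
by rewrite mul1n addnC eqn_add2r; case: eqP => // h; lia.
Qed.

(** * Divisibility of residues modulo [N] *)

Section Residues.

Variables (m N : nat).
Hypotheses (N_gt1 : 1 < N) (mN : m %| N).
Local Open Scope ring_scope.
Local Notation G := 'Z_N.

Lemma val_natr (k : nat) : val (k%:R : G) = (k %% N)%N.
Proof. by rewrite /= val_Zp_nat. Qed.

Lemma val_ltn (z : G) : (val z < N)%N.
Proof. by rewrite -[X in (_ < X)%N](Zp_cast N_gt1) ltn_ord. Qed.

Lemma val_addr (z w : G) : val (z + w) = ((val z + val w) %% N)%N.
Proof. by congr modn; apply: Zp_cast. Qed.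

Lemma dvdn_val_natr k : (m %| val (k%:R : G)%R)%N = (m %| k)%N.
Proof. by rewrite val_natr /dvdn modn_dvdm. Qed.

Lemma dvdn_val_addr (z w : G) :
  (m %| val z)%N -> (m %| val (z + w)%R)%N = (m %| val w)%N.
Proof. by move=> mz; rewrite val_addr /dvdn modn_dvdm // -/(dvdn _ _) dvdn_addr. Qed.

Lemma dvdn_val_oppr (z : G) : (m %| val (- z)%R)%N = (m %| val z)%N.
Proof.
apply/idP/idP => h; first by have := dvdn_val_addr z h; rewrite addNr /= dvdn0.
by have := dvdn_val_addr (- z) h; rewrite subrr /= dvdn0.
Qed.

End Residues.

(** * The edge colouring defined by a list of tiles *)

Section Tiles.

Variables (m M N : nat) (T : seq (nat * seq piece)).
Hypotheses (M_even : ~~ odd M) (M_gt0 : 0 < M) (defN : N = M.*2) (mM : m %| M).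
Hypothesis T_ok : all (tile_ok M) T.
Hypothesis T_diffs :
  perm_eq (tiles_diffs M T) [seq d <- iota 1 M./2 | ~~ (m %| d)].

Local Open Scope ring_scope.
Local Notation G := 'Z_N.
Let u : G := M%:R.
Definition nonmult : {pred G} := [pred z : G | ~~ (m %| val z)%N].

Let N_gt1 : (1 < N)%N. Proof. by clear -M_gt0 defN; lia. Qed.

Let mN : (m %| N)%N. Proof. by rewrite defN -addnn dvdn_addr. Qed.

Let valN k := @val_natr N N_gt1 k.

Lemma uDu : u + u = 0.
Proof. by apply: val_inj; rewrite val_addr // valN /= defN -addnn modnDm modnn. Qed.

Lemma nonmultN z : (- z \in nonmult) = (z \in nonmult).
Proof. by rewrite !inE (dvdn_val_oppr N_gt1). Qed.

Lemma nonmultDu z : (z + u \in nonmult) = (z \in nonmult).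
Proof. by rewrite !inE addrC dvdn_val_addr // dvdn_val_natr. Qed.

Lemma nonmult_nat (d : nat) : (d%:R \in nonmult) = ~~ (m %| d)%N.
Proof. by rewrite inE dvdn_val_natr. Qed.

(* The corner [(v, (d, d'))] records the two half-edges [d], [d'] of a cycle at its
   vertex [v].  Only one vertex of each coset of [{0, u}] is listed: translation by
   [u] maps the 2-factor to itself. *)
Definition corners (p : piece) : seq (G * (G * G)) :=
  match p with
  | Edge x d => [:: (x%:R, (d%:R, d%:R + u)); ((x + d)%:R, (- d%:R, - d%:R + u))]
  | Para x d e =>
    [:: (x%:R, (d%:R, e%:R + u)); ((x + d)%:R, (- d%:R, e%:R));
        ((x + d + e)%:R, (- e%:R, - d%:R + u)); ((x + e)%:R, (d%:R + u, - e%:R + u))]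
  | Loop x => [:: (x%:R, (M./2%:R, M./2%:R + u))]
  end.

(** Representative of [z] modulo [M] and up to sign; for [z] in [nonmult] it lies between [1] and
    [M / 2]. *)
Definition rep (z : G) : nat := minn (val z %% M) (M - val z %% M).

Definition at_half (z : G) (c : G * (G * G)) : bool :=
  (c.2.1 == z) || (c.2.2 == z).

Lemma eq_nat_val (d : nat) (z : G) : (d < N)%N -> (d%:R == z) = (val z == d).
Proof. by move=> dN; rewrite -val_eqE valN modn_small // eq_sym. Qed.

Lemma natM_sub (d : nat) : (d <= N)%N -> - d%:R = (M.*2 - d)%:R :> G.
Proof.
move=> dN; have N0 : N%:R = 0 :> G by apply: val_inj; rewrite valN modnn.
by rewrite -defN natrB // N0 sub0r.
Qed.

Lemma half_eqs (d : nat) (z : G) : (0 < d)%N -> (d.*2 <= M)%N ->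
  [/\ (d%:R == z) = (val z == d), (d%:R + u == z) = (val z == d + M)%N,
      (- d%:R == z) = (val z == M.*2 - d)%N & (- d%:R + u == z) = (val z == M - d)%N].
Proof.
move=> d0 dM; rewrite -natrD natM_sub; last by lia.
have -> : (M.*2 - d)%:R + u = (M - d)%:R.
  have E : (M.*2 - d + M = M - d + M.*2)%N by clear -d0 dM; lia.
  by apply: val_inj; rewrite -natrD !valN E -defN modnDr.
by split; rewrite eq_nat_val // defN; clear -d0 dM; lia.
Qed.

Lemma val_split (z : G) : z \in nonmult -> exists q r,
  [/\ val z = q * M + r, 0 < r, r < M, q < 2 & rep z = minn r (M - r)]%N.
Proof.
move=> zD; exists (val z %/ M)%N, (val z %% M)%N; rewrite -divn_eq ltn_mod M_gt0.
rewrite ltn_divLR // mul2n -defN val_ltn // lt0n; split=> //.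
by apply: contraNN zD => /dvdnP[k ->]; rewrite dvdn_mull.
Qed.

Lemma count_corners s p z : piece_ok M s p -> z \in nonmult ->
  count (at_half z) (corners p) = count_mem (rep z) (diffs M p).
Proof.
move=> ok zD; have [q [r [zE r0 rM q2 ->]]] := val_split zD.
case: p ok => [x d|x d e|x] /=; rewrite /at_half /= ?addn0.
- case/andP=> d0 dM; have [-> -> -> ->] := half_eqs z d0 (ltnW dM).
  by rewrite zE edge_half_count // half_count_nat.
- case/and4P=> d0 dM e0 eM; have [-> -> -> ->] := half_eqs z d0 (ltnW dM).
  have [-> -> -> ->] := half_eqs z e0 (ltnW eM).
  by rewrite zE para_half_count // !half_count_nat.
- have h0 : (0 < M./2)%N by clear -M_even M_gt0; lia.
  have hM : (M./2.*2 <= M)%N by clear; lia.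
  by move=> _; have [-> -> _ _] := half_eqs z h0 hM; rewrite zE loop_half_count.
Qed.
Definition tile (i : nat) : nat * seq piece := nth (0%N, [::]) T i.

Definition tile_corners (i : nat) : seq (G * (G * G)) :=
  flatten [seq corners p | p <- (tile i).2].

Definition all_corners : seq (nat * (G * (G * G))) :=
  flatten [seq [seq (i, c) | c <- tile_corners i] | i <- iota 0 (size T)].

Lemma mem_all_corners i c :
  ((i, c) \in all_corners) = (i < size T)%N && (c \in tile_corners i).
Proof.
apply/flatten_mapP/andP => [[j]|[iT ci]].
  by rewrite mem_iota => /andP[_ jT] /mapP[c' c'j [-> ->]].
by exists i; [rewrite mem_iota | apply/mapP; exists c].
Qed.

Lemma tile_mem i : (i < size T)%N -> tile_ok M (tile i).
Proof. by move=> iT; apply: (allP T_ok); apply: mem_nth. Qed.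

Lemma tile_dvd i : (i < size T)%N -> ((tile i).1 %| M)%N.
Proof. by case/tile_mem/and3P. Qed.

Lemma rep_mem z : z \in nonmult -> rep z \in [seq d <- iota 1 M./2 | ~~ (m %| d)%N].
Proof.
move=> zD; have [q [r [zE r0 rM q2 ->]]] := val_split zD.
have mr : ~~ (m %| r)%N.
  move: zD; rewrite inE zE; apply: contraNN => mr.
  by rewrite dvdn_addr // dvdn_mull.
rewrite mem_filter mem_iota; apply/andP; split; last first.
  by clear -M_even r0 rM; rewrite /minn; case: ifP => h; apply/andP; split; lia.
rewrite /minn; case: ifP => // _; apply: contraNN mr => mMr.
by rewrite -(dvdn_addl _ mMr) subnKC // ltnW.
Qed.

(** By [count_corners], [z] occurs in the corners as often as [rep z] in the differences of the
    tiles, which is once by [T_diffs]. *)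
Lemma count_at_half z : z \in nonmult ->
  count (fun c => at_half z c.2) all_corners = 1%N.
Proof.
move=> zD; rewrite count_flatten -map_comp.
transitivity (count_mem (rep z) (tiles_diffs M T)).
  have -> : tiles_diffs M T =
      flatten [seq flatten [seq diffs M p | p <- (tile i).2] | i <- iota 0 (size T)].
    by rewrite /tiles_diffs -[in LHS](mkseq_nth (0%N, [::]) T) -map_comp.
  rewrite count_flatten -map_comp.
  congr sumn; apply/eq_in_map => i; rewrite mem_iota => /andP[_ iT] /=.
  rewrite count_map /preim /tile_corners !count_flatten -!map_comp.
  congr sumn; apply/eq_in_map => p pi /=.
  have /and3P[_ /allP/(_ p pi) ok _] := tile_mem iT.
  exact: count_corners ok zD.
rewrite (permP T_diffs) count_uniq_mem ?filter_uniq ?iota_uniq //.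
by rewrite rep_mem.
Qed.

Lemma count1_eq (S : eqType) (P : pred S) (s : seq S) x y :
  count P s = 1%N -> x \in s -> P x -> y \in s -> P y -> x = y.
Proof.
rewrite -size_filter => h xs Px ys Py.
have : x \in filter P s by rewrite mem_filter Px.
have : y \in filter P s by rewrite mem_filter Py.
by case: (filter P s) h => [|a []] //= _; rewrite !inE => /eqP-> /eqP->.
Qed.

Lemma uniq_map_inj (A B : eqType) (f : A -> B) (s : seq A) x y :
  uniq (map f s) -> x \in s -> y \in s -> f x = f y -> x = y.
Proof.
elim: s => //= a s IH /andP[fa us]; rewrite !inE => /predU1P[->|xs] /predU1P[->|ys] //.
- by move=> e; rewrite e map_f in fa.
- by move=> e; rewrite -e map_f in fa.
exact: IH.
Qed.

(** For [z] in [nonmult], [count_at_half] makes this the only corner having [z] as a half-edge, and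
    the default is not reached. *)
Definition corner (z : G) : nat * (G * (G * G)) :=
  nth (0%N, (0, (0, 0))) all_corners (find (fun c => at_half z c.2) all_corners).

Definition nu (z : G) : G :=
  let c := (corner z).2.2 in if c.1 == z then c.2 else c.1.

Definition red (i : nat) (v : G) : nat := (val v %% (tile i).1)%N.

(** A colour names a tile and a translate of its 2-factor: the second component is, up to sign, the
    shift modulo the tile's modulus that takes the vertex of the corner to [x]. *)
Definition col (x z : G) : nat * nat :=
  ((corner z).1, red (corner z).1 ((corner z).2.1 - x)).

Definition adj (i : nat) (v d d' : G) : bool :=
  ((i, (v, (d, d'))) \in all_corners) || ((i, (v, (d', d))) \in all_corners).

Lemma adjC i v d d' : adj i v d d' = adj i v d' d.
Proof. by rewrite /adj orbC. Qed.

Lemma half_vals (d : nat) : (0 < d)%N -> (d.*2 <= M)%N ->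
  [/\ val (d%:R : G) = d, val (d%:R + u : G) = (d + M)%N,
     val (- d%:R : G) = (M.*2 - d)%N & val (- d%:R + u : G) = (M - d)%N].
Proof.
move=> d0 dM; split; apply/eqP.
- by have [<-] := half_eqs d%:R d0 dM.
- by have [_ <-] := half_eqs (d%:R + u) d0 dM.
- by have [_ _ <-] := half_eqs (- d%:R) d0 dM.
- by have [_ _ _ <-] := half_eqs (- d%:R + u) d0 dM.
Qed.

Lemma corners_mem i p c : (i < size T)%N -> p \in (tile i).2 -> c \in corners p ->
  [/\ c.2.1 \in nonmult, c.2.2 \in nonmult & c.2.1 != c.2.2].
Proof.
move=> iT pi; have /and3P[_ /allP/(_ p pi) ok _] := tile_mem iT.
have nd d : d \in diffs M p -> d%:R \in nonmult.
  move=> dp; rewrite nonmult_nat.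
  have : d \in tiles_diffs M T.
    apply/flatten_mapP; exists (tile i); first exact: mem_nth.
    by apply/flatten_mapP; exists p.
  by rewrite (perm_mem T_diffs) mem_filter => /andP[].
case: p pi ok nd => [x d|x d e|x] _ /=.
- case/andP=> d0 dM nd; have dD : d%:R \in nonmult by rewrite nd ?inE.
  have [v1 v2 v3 v4] := half_vals d0 (ltnW dM).
  rewrite mem_seq2 => /orP[]/eqP-> /=; rewrite ?(nonmultDu, nonmultN) dD; split=> //.
    by rewrite -val_eqE v1 v2; apply/eqP; clear -d0 dM; lia.
  by rewrite -val_eqE v3 v4; apply/eqP; clear -d0 dM; lia.
- case/and4P=> d0 dM e0 eM nd.
  have dD : d%:R \in nonmult by rewrite nd ?inE ?eqxx.
  have eD : e%:R \in nonmult by rewrite nd ?inE ?eqxx ?orbT.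
  have [v1 v2 v3 v4] := half_vals d0 (ltnW dM).
  have [w1 w2 w3 w4] := half_vals e0 (ltnW eM).
  rewrite mem_seq4 => /or4P[]/eqP-> /=; rewrite ?(nonmultDu, nonmultN) dD eD; split=> //;
  by rewrite -val_eqE ?(v1, v2, v3, v4, w1, w2, w3, w4); apply/eqP; clear -d0 dM e0 eM; lia.
- move=> _ nd; have hD : M./2%:R \in nonmult by rewrite nd ?inE ?eqxx.
  have h0 : (0 < M./2)%N by clear -M_even M_gt0; lia.
  have hM : (M./2.*2 <= M)%N by clear; lia.
  have [v1 v2 v3 v4] := half_vals h0 hM.
  rewrite mem_seq1 => /eqP-> /=; rewrite nonmultDu hD; split=> //.
  by rewrite -val_eqE v1 v2; apply/eqP; clear -M_gt0; lia.
Qed.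

Lemma adj_nonmult i v d d' : adj i v d d' -> d \in nonmult /\ d != d'.
Proof.
case/orP; rewrite mem_all_corners => /andP[iT /flattenP[cs /mapP[p pi ->]]].
  by move/(corners_mem iT pi) => [].
by rewrite eq_sym; move/(corners_mem iT pi) => [].
Qed.

Lemma adjP i v d d' : adj i v d d' ->
  nu d = d' /\ forall x, col x d = (i, red i (v - x)).
Proof.
move=> h; have [dD dd'] := adj_nonmult h; have c1 := count_at_half dD.
have hascs : has (fun c => at_half d c.2) all_corners by rewrite has_count c1.
have inc : corner d \in all_corners by rewrite mem_nth // -has_find.
have hc : at_half d (corner d).2 by apply: (nth_find _ hascs).
rewrite /nu /col; case/orP: h => h.
  have -> : corner d = (i, (v, (d, d'))).
    by apply: (count1_eq c1) => //; rewrite /at_half /= eqxx.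
  by rewrite /= eqxx.
have -> : corner d = (i, (v, (d', d))).
  by apply: (count1_eq c1) => //; rewrite /at_half /= eqxx orbT.
by rewrite /= eq_sym (negbTE dd').
Qed.

Lemma adj_ex d : d \in nonmult -> exists i v, adj i v d (nu d).
Proof.
move=> dD; have c1 := count_at_half dD.
have hascs : has (fun c => at_half d c.2) all_corners by rewrite has_count c1.
have inc : corner d \in all_corners by rewrite mem_nth // -has_find.
have hc : at_half d (corner d).2 by apply: (nth_find _ hascs).
case E : (corner d) inc hc => [i [v [a b]]]; rewrite /at_half /= => inc hc.
exists i, v; rewrite /nu E /adj /=.
by case: eqP hc => [<- _|_ /= /eqP<-]; rewrite inc ?orbT.
Qed.

Lemma red_add i a b c : (i < size T)%N ->
  red i a = red i b -> red i (a + c) = red i (b + c).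
Proof.
move=> iT ab; have sN : ((tile i).1 %| N)%N.
  by rewrite defN -addnn dvdn_add // tile_dvd.
move: ab; rewrite /red !val_addr // !modn_dvdm // => ab.
by rewrite -modnDml ab modnDml.
Qed.

Lemma red_nat i (k : nat) : (i < size T)%N -> red i k%:R = (k %% (tile i).1)%N.
Proof.
move=> iT; rewrite /red valN modn_dvdm //.
by rewrite defN -addnn dvdn_add // tile_dvd.
Qed.

Lemma redDu i a : (i < size T)%N -> red i (a + u) = red i a.
Proof.
move=> iT; rewrite [X in X = _](_ : _ = red i (u + a)); last by rewrite addrC.
rewrite (@red_add i u 0 a iT) ?add0r // red_nat // (eqP (tile_dvd iT)).
by rewrite /red mod0n.
Qed.

Lemma oppu : - u = u.
Proof. by apply/eqP; rewrite eq_sym -addr_eq0 uDu. Qed.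

(** Local form of [colN] and [nu_square]: both half-edges lead to corners of the same piece, and the
    two walks close up after a second step. Vertices are compared through [red], which ignores [u]
    because the modulus divides [M]. *)
Lemma corners_step i p v d d' : (i < size T)%N -> p \in (tile i).2 ->
  (v, (d, d')) \in corners p ->
  exists v1 v2 f f',
  [/\ adj i v1 (- d) f, adj i v2 (- d') f',
     red i v1 = red i (v + d), red i v2 = red i (v + d') & d + f = d' + f'].
Proof.
move=> iT pi; have /and3P[_ /allP/(_ p pi) ok _] := tile_mem iT.
have adj1 w c c' : (w, (c, c')) \in corners p -> adj i w c c'.
  move=> h; rewrite /adj mem_all_corners iT /=; apply/orP; left.
  by apply/flattenP; exists (corners p) => //; apply: map_f.
have adj2 w c c' : (w, (c', c)) \in corners p -> adj i w c c'.
  by rewrite adjC; apply: adj1.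
have Nuu (c : G) : - (c + u) = - c + u by rewrite opprD oppu.
have NNu (c : G) : - (- c + u) = c + u by rewrite Nuu opprK.
have cuu (c : G) : c + u + u = c by rewrite -addrA uDu addr0.
clear pi; case: p ok adj1 adj2 => [x a|x a b|x] ok adj1 adj2.
- have [m1 m2] : (x%:R, (a%:R, a%:R + u)) \in corners (Edge x a) /\
      ((x + a)%:R, (- a%:R, - a%:R + u)) \in corners (Edge x a).
    by rewrite /= !mem_seq2 !eqxx ?orbT.
  rewrite /= mem_seq2 => /orP[]/eqP[-> -> ->].
    exists (x + a)%:R, (x + a)%:R, (- a%:R + u), (- a%:R).
    split; rewrite ?Nuu; try (by [apply: adj1 | apply: adj2]);
      rewrite ?natrD ?addrA ?redDu //.
    by rewrite subrr add0r addrAC subrr add0r.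
  exists x%:R, x%:R, (a%:R + u), (a%:R).
  split; rewrite ?NNu ?opprK; try (by [apply: adj1 | apply: adj2]);
      rewrite ?natrD ?addrA ?redDu ?addrK //.
  by rewrite addNr add0r addrAC addNr add0r.
- have [m1 m2 m3 m4] : [/\ (x%:R, (a%:R, b%:R + u)) \in corners (Para x a b),
      ((x + a)%:R, (- a%:R, b%:R)) \in corners (Para x a b),
      ((x + a + b)%:R, (- b%:R, - a%:R + u)) \in corners (Para x a b) &
      ((x + b)%:R, (a%:R + u, - b%:R + u)) \in corners (Para x a b)].
    by rewrite /= !mem_seq4 !eqxx ?orbT.
  rewrite /= mem_seq4 => /or4P[]/eqP[-> -> ->].
  + exists (x + a)%:R, (x + b)%:R, b%:R, (a%:R + u).
    split; rewrite ?Nuu; try (by [apply: adj1 | apply: adj2]);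
      rewrite ?natrD ?addrA ?redDu //.
    by rewrite (addrAC b%:R) cuu addrC.
  + exists x%:R, (x + a + b)%:R, (b%:R + u), (- a%:R + u).
    split; rewrite ?opprK; try (by [apply: adj1 | apply: adj2]);
      rewrite ?natrD ?addrA ?redDu ?addrK //.
    by rewrite (addrC b%:R).
  + exists (x + a)%:R, (x + b)%:R, (- a%:R), (- b%:R + u).
    split; rewrite ?NNu ?opprK; try (by [apply: adj1 | apply: adj2]);
      rewrite ?natrD ?addrA ?redDu ?addrK //.
      by rewrite (addrAC x%:R) addrK.
    by rewrite (addrAC _ u) cuu addrC.
  + exists (x + a + b)%:R, x%:R, (- b%:R), a%:R.
    split; rewrite ?NNu ?Nuu ?opprK; try (by [apply: adj1 | apply: adj2]);
      rewrite ?natrD ?addrA ?redDu ?addrK //.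
      by rewrite addrAC.
    by rewrite addrAC [RHS]addrC addrA addrAC.
- have m1 : (x%:R, (M./2%:R, M./2%:R + u)) \in corners (Loop x).
    by rewrite /= mem_seq1 eqxx.
  have hh : M./2%:R + M./2%:R = u.
    by rewrite -natrD addnn; congr _%:R; clear -M_even; lia.
  have Nh : - M./2%:R = M./2%:R + u.
    by apply/eqP; rewrite eq_sym -addr_eq0 addrAC hh uDu.
  (* [piece_ok] makes the modulus divide [M / 2], so the four vertices of the coset share a single
     corner. *)
  have redh w : red i (w + M./2%:R) = red i w.
    rewrite addrC (@red_add i _ 0 w iT) ?add0r // red_nat //.
    have sM : ((tile i).1 %| M./2)%N := ok.
    by rewrite (eqP sM) /red mod0n.
  rewrite /= mem_seq1 => /eqP[-> -> ->].
  exists x%:R, x%:R, M./2%:R, (M./2%:R + u).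
  split; rewrite ?Nuu ?Nh ?cuu; try (by [apply: adj1 | apply: adj2]);
      rewrite ?addrA ?redDu ?redh //.
  by rewrite (addrAC _ u) cuu.
Qed.

Lemma adj_step i v d d' : adj i v d d' -> exists v1 v2 f f',
  [/\ adj i v1 (- d) f, adj i v2 (- d') f',
     red i v1 = red i (v + d), red i v2 = red i (v + d') & d + f = d' + f'].
Proof.
case/orP; rewrite mem_all_corners => /andP[iT /flattenP[cs /mapP[p pi ->]]].
  exact: corners_step.
case/(corners_step iT pi) => v1 [v2 [f [f' [h1 h2 h3 h4 h5]]]].
by exists v2, v1, f', f.
Qed.

Lemma adj_size i v d d' : adj i v d d' -> (i < size T)%N.
Proof. by case/orP; rewrite mem_all_corners => /andP[]. Qed.

Lemma verts_corners i : (i < size T)%N ->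
  [seq red i c.1 | c <- tile_corners i] =
  [seq (v %% (tile i).1)%N | v <- flatten (map verts (tile i).2)].
Proof.
move=> iT; rewrite /tile_corners !map_flatten -!map_comp; congr flatten.
by apply: eq_map => -[x d|x d e|x] /=; rewrite !red_nat.
Qed.

Lemma red_corner_ex i (r : nat) : (i < size T)%N -> (r < (tile i).1)%N ->
  exists v d d', adj i v d d' /\ red i v = r.
Proof.
move=> iT rs; have /and3P[_ _ pm] := tile_mem iT.
have : r \in iota 0 (tile i).1 by rewrite mem_iota.
rewrite -(perm_mem pm) -verts_corners // => /mapP[[v [d d']] h ->].
by exists v, d, d'; rewrite /adj mem_all_corners iT h.
Qed.

(** The tile covers each residue once, so the residue determines the corner and with it the
    unordered pair of half-edges. *)
Lemma red_corner_uniq i v v' d d' f f' :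
  adj i v d d' -> adj i v' f f' -> red i v = red i v' -> f = d \/ f = d'.
Proof.
move=> h1 h2 vv'; have iT := adj_size h1.
have un : uniq [seq red i c.1 | c <- tile_corners i].
  have /and3P[_ _ pm] := tile_mem iT.
  by rewrite verts_corners // (perm_uniq pm) iota_uniq.
move: h1 h2; rewrite /adj !mem_all_corners iT /=.
have inj c c' h1 h2 := @uniq_map_inj _ _ _ _ c c' un h1 h2.
by case/orP=> /inj h /orP[] /h /(_ vv') [_ -> ->]; auto.
Qed.

Theorem tiles_cyclic_factorization (e : rel G) :
  (forall x y, e x y = (y - x \in nonmult)) ->
  exists Fs, is_cycle_factorization e 4 Fs /\ is_cyclic Fs.
Proof.
move=> eD.
have D0 : 0 \notin nonmult by rewrite inE /= dvdn0.
have DN : {in nonmult, forall d, - d \in nonmult}.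
  by move=> d; rewrite nonmultN.
have nuD : {in nonmult, forall d, nu d \in nonmult}.
  move=> d dD; have [i [v h]] := adj_ex dD.
  by move: h; rewrite adjC => /adj_nonmult[].
have nu_neq : {in nonmult, forall d, nu d != d}.
  move=> d dD; have [i [v h]] := adj_ex dD.
  by have [_] := adj_nonmult h; rewrite eq_sym.
have step d : d \in nonmult -> exists i v1 v2 v, [/\ adj i v d (nu d),
    adj i v1 (- d) (nu (- d)), adj i v2 (- nu d) (nu (- nu d)),
    red i v1 = red i (v + d) & d + nu (- d) = nu d + nu (- nu d)].
  move=> dD; have [i [v h]] := adj_ex dD.
  have [v1 [v2 [f [f' [h1 h2 h3 h4 h5]]]]] := adj_step h.
  have [e1 _] := adjP h1; have [e2 _] := adjP h2.
  by exists i, v1, v2, v; rewrite e1 e2.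
have colN x : {in nonmult, forall d, col (x + d) (- d) = col x d}.
  move=> d dD; have [i [v1 [v2 [v [h h1 _ h3 _]]]]] := step d dD.
  have [_ ->] := adjP h1; have [_ ->] := adjP h; congr pair.
  by rewrite (red_add _ (adj_size h) h3) opprD addrACA subrr addr0.
have col_nu x : {in nonmult, forall d, col x (nu d) = col x d}.
  move=> d dD; have [i [v h]] := adj_ex dD.
  have [_ ->] := adjP h; move: h; rewrite adjC => h.
  by have [_ ->] := adjP h.
have col_inv x y d d' : d \in nonmult -> d' \in nonmult -> col x d = col y d' ->
    exists i v v', [/\ adj i v d (nu d), adj i v' d' (nu d') &
      red i (v - x) = red i (v' - y)].
  move=> dD d'D; have [i [v h]] := adj_ex dD; have [j [v' h']] := adj_ex d'D.
  have [_ ->] := adjP h; have [_ ->] := adjP h' => -[ij r].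
  by subst j; exists i, v, v'.
exists (color_classes nonmult col nu); split.
  apply: color_classes_factorization => //.
  - move=> x d d' dD d'D /(col_inv _ _ _ _ dD d'D)[i [v [v' [h h' r]]]].
    apply: (red_corner_uniq h h').
    by have := red_add x (adj_size h) r; rewrite !subrK.
  - by move=> d /step[i [v1 [v2 [v []]]]].
  - move=> x y d dD; have [i [v h]] := adj_ex dD; have iT := adj_size h.
    have s0 : (0 < (tile i).1)%N.
      by have := tile_dvd iT; case: (tile i).1 => //; rewrite dvd0n; case: (M) M_gt0.
    (* The corner of the same tile at the residue of [v - x + y] carries, at [y], the shift that [d]
       has at [x]. *)
    have [v' [d' [d'' [h' r]]]] := red_corner_ex iT (ltn_pmod (val (v - x + y)) s0).
    exists d'; first by have [] := adj_nonmult h'.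
    have [_ ->] := adjP h; have [_ ->] := adjP h'; congr pair.
    by rewrite (red_add _ iT (r : _ = red i (v - x + y))) addrK.
apply: color_classes_cyclic => //.
move=> x y g d d' dD d'D /(col_inv _ _ _ _ dD d'D)[i [v [v' [h h' r]]]].
have [_ ->] := adjP h; have [_ ->] := adjP h'; congr pair.
by rewrite !opprD !addrA; apply: red_add (adj_size h) _.
Qed.

End Tiles.

(** * Tilings of lists of differences *)

Lemma perm_by_size (A : eqType) (s1 s2 : seq A) :
  uniq s1 -> {subset s1 <= s2} -> size s2 <= size s1 -> perm_eq s1 s2.
Proof.
move=> u1 s12 sz; have [_ e] := uniq_min_size u1 s12 sz.
by apply: uniq_perm => //; apply: leq_size_uniq u1 s12 sz.
Qed.

Definition tiled (M : nat) (S : seq nat) : Prop :=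
  exists2 T, all (tile_ok M) T & perm_eq (tiles_diffs M T) S.

Lemma tiled_perm M S S' : perm_eq S S' -> tiled M S -> tiled M S'.
Proof. by move=> SS' [T T_ok TS]; exists T => //; apply: perm_trans TS SS'. Qed.

Lemma tiled_cat M S S' : tiled M S -> tiled M S' -> tiled M (S ++ S').
Proof.
move=> [T T_ok TS] [T' T'_ok TS']; exists (T ++ T'); first by rewrite all_cat T_ok.
by rewrite /tiles_diffs map_cat flatten_cat; apply: perm_cat.
Qed.

Lemma tiled_tile M s P : tile_ok M (s, P) -> tiled M (flatten (map (diffs M) P)).
Proof. by move=> ok; exists [:: (s, P)]; rewrite ?/tiles_diffs /= ?cats0 ?ok. Qed.

Lemma tiled_odd M (S : seq nat) : ~~ odd M ->
  {in S, forall d, odd d && (d.*2 < M)} -> tiled M S.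
Proof.
move=> M_even; elim: S => [|d S IH] dS; first by exists [::].
rewrite -cat1s; apply: tiled_cat; last first.
  by apply: IH => e eS; apply: dS; rewrite inE eS orbT.
have /andP[d_odd dM] : odd d && (d.*2 < M) by apply: dS; rewrite inE eqxx.
have := @tiled_tile M 2 [:: Edge 0 d]; apply.
by rewrite /tile_ok /= dM odd_gt0 // dvdn2 M_even add0n !modn2 d_odd.
Qed.

(** Odd differences outside [L] are tiled one by one, so [L] need only contain the even differences
    and whatever odd ones help to tile them. *)
Lemma tiled_fill M L S : ~~ odd M -> uniq L -> uniq S -> {subset L <= S} ->
  {in S, forall d, d \notin L -> odd d && (d.*2 < M)} -> tiled M L -> tiled M S.
Proof.
move=> M_even uL uS LS odds tL.
have : perm_eq (L ++ [seq d <- S | d \notin L]) S.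
  apply: perm_trans (permEl (perm_filterC (mem L) S)); apply: perm_cat => //.
  apply: uniq_perm => //; first exact: filter_uniq.
  by move=> d; rewrite mem_filter; apply/idP/andP=> [dL|[]//]; split=> //; apply: LS.
move/tiled_perm; apply; apply: tiled_cat tL _; apply: tiled_odd => // d.
by rewrite mem_filter => /andP[dL /odds]; apply.
Qed.

(** * Coverings of residues and their affine images *)

Definition covers (s : nat) (P : seq piece) : bool :=
  perm_eq [seq v %% s | v <- flatten (map verts P)] (iota 0 s).

(** There are as many vertices as residues, so hitting every residue suffices. *)
Lemma covers_by s P : size (flatten (map verts P)) = s ->
  (forall r, r < s -> exists p v, [/\ p \in P, v \in verts p & v = r %[mod s]]) ->
  covers s P.
Proof.
move=> sz h; rewrite /covers perm_sym; apply: perm_by_size; first exact: iota_uniq.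
  move=> r; rewrite mem_iota => /andP[_ rs]; have [p [v [pP vp e]]] := h r rs.
  rewrite -[r](modn_small rs) -e; apply: map_f; apply/flatten_mapP.
  by exists p.
by rewrite size_map sz size_iota.
Qed.

(** With [b] prime to the modulus and [B] a multiple of it, vertices are just multiplied by [b] in
    the quotient, while the differences move into the range above [B]. *)
Definition affine (b B : nat) (p : piece) : piece :=
  match p with
  | Edge x d => Edge (b * x) (B + b * d)
  | Para x d e => Para (b * x) (B + b * d) (B + b * e)
  | Loop x => Loop (b * x)
  end.

Lemma covers_affine s b B P : coprime b s -> s %| B ->
  covers s P -> covers s (map (affine b B) P).
Proof.
move=> bs sB cP; rewrite /covers.
have -> : [seq v %% s | v <- flatten (map verts (map (affine b B) P))] =
    [seq (b * v) %% s | v <- [seq v %% s | v <- flatten (map verts P)]].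
  rewrite -!map_comp !map_flatten -!map_comp; congr flatten.
  apply: eq_map => p /=.
  have add x k : (x + k * B) %% s = x %% s.
    by rewrite -modnDmr -modnMmr (eqP sB) muln0 mod0n addn0.
  case: p => [x d|x d e|x] /=; rewrite ?modnMmr //.
    by rewrite -(add (b * (x + d)) 1); congr [:: _; _ %% s]; lia.
  rewrite -(add (b * (x + d)) 1) -(add (b * (x + d + e)) 2) -(add (b * (x + e)) 1).
  by congr [:: _; _ %% s; _ %% s; _ %% s]; lia.
have inj x y : x <= y -> y < s -> (b * x) %% s = (b * y) %% s -> x = y.
  move=> xy ys /eqP; rewrite eq_sym eqn_mod_dvd ?leq_mul2l ?xy ?orbT // -mulnBr.
  rewrite Gauss_dvdr 1?coprime_sym // /dvdn modn_small; last by lia.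
  by move/eqP; lia.
have fs := perm_map (fun v => (b * v) %% s) cP.
apply: perm_trans fs _; apply: perm_by_size.
- rewrite map_inj_in_uniq ?iota_uniq // => x y.
  rewrite !mem_iota !add0n => /= xs ys e.
  by case/orP: (leq_total x y) => h; [|symmetry]; apply: inj.
- move=> r /mapP[x]; rewrite !mem_iota /= add0n => xs ->.
  by rewrite ltn_pmod //; apply: leq_ltn_trans xs.
- by rewrite size_map.
Qed.

(** * Reflections and the case of even [m] *)

Lemma size_flatten_const (A B : Type) (f : A -> seq B) (r : seq A) k :
  (forall x, size (f x) = k) -> size (flatten [seq f x | x <- r]) = k * size r.
Proof. by move=> h; elim: r => [|x r IH] //=; rewrite ?size_cat ?IH ?h; lia. Qed.

(* The pairs [{- j, j}] modulo [w], for [a <= j < a + k]. *)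
Definition reflection (w a k : nat) : seq piece :=
  [seq Edge (w - j) j.*2 | j <- iota a k].

Lemma mem_reflection w a k j : a <= j < a + k -> Edge (w - j) j.*2 \in reflection w a k.
Proof. by move=> h; apply/mapP; exists j; rewrite // mem_iota. Qed.

Lemma size_reflection w a k : size (flatten (map verts (reflection w a k))) = k.*2.
Proof. by rewrite -map_comp (@size_flatten_const _ _ _ _ 2) // size_iota mul2n. Qed.

(** [a + k = uphalf w] makes [j] run through all integers from [a] that are below [w / 2]; only
    [w / 2] and the residues closer than [a] to [0] are missed. *)
Lemma reflection_covers w a k r : a + k = uphalf w -> 0 < a ->
  a <= r -> r <= w - a -> r.*2 != w ->
  exists p v, [/\ p \in reflection w a k, v \in verts p & v = r %[mod w]].
Proof.
move=> ak a0 ar rw /eqP r2; have [rw2|rw2] := ltnP r.*2 w.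
  exists (Edge (w - r) r.*2), (w - r + r.*2); split.
  - by apply: mem_reflection; lia.
  - by rewrite !inE eqxx orbT.
  - by rewrite (_ : w - r + r.*2 = r + w) ?modnDr //; lia.
exists (Edge (w - (w - r)) (w - r).*2), (w - (w - r)); split.
- by apply: mem_reflection; lia.
- by rewrite !inE eqxx.
- by congr modn; lia.
Qed.

(** For odd [w] the only fixed point of the reflection is [0], left to a [Loop]. *)
Lemma reflection_odd_covers w : odd w -> covers w (Loop 0 :: reflection w 1 w./2).
Proof.
move=> w_odd; apply: covers_by => [|r rw].
  by rewrite /= size_reflection; lia.
have [->|r0] := eqVneq r 0.
  by exists (Loop 0), 0; rewrite !inE eqxx.
have [|||||p [v [pP vp e]]] := @reflection_covers w 1 w./2 r; try lia.
by exists p, v; rewrite inE pP orbT.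
Qed.

(** The fixed points [0] and [w / 2] are joined; as [w / 2] is odd, it does not repeat a reflection
    difference. *)
Lemma reflection_mod4_2_covers w : w %% 4 = 2 ->
  covers w (Edge 0 w./2 :: reflection w 1 w./2.-1).
Proof.
move=> w2; apply: covers_by => [|r rw].
  by rewrite /= size_reflection; lia.
have [->|r0] := eqVneq r 0.
  by exists (Edge 0 w./2), 0; rewrite !inE eqxx.
have [->|r1] := eqVneq r w./2.
  by exists (Edge 0 w./2), w./2; rewrite !inE eqxx add0n eqxx orbT.
have [|||||p [v [pP vp e]]] := @reflection_covers w 1 w./2.-1 r; try lia.
by exists p, v; rewrite inE pP orbT.
Qed.

(** Now [w / 2] is even and already a reflection difference, so the fixed points [0] and [w / 2] are
    joined to [1] and [-1] with odd differences. The price is the pair [{-1, 1}] of difference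
    [2]. *)
Lemma reflection_mod4_0_covers w : 4 %| w -> 4 < w ->
  covers w (Edge 0 1 :: Edge w.-1 w./2.+1 :: reflection w 2 w./2.-2).
Proof.
move=> w4 w5; apply: covers_by => [|r rw].
  by rewrite /= size_reflection; lia.
have [->|r0] := eqVneq r 0.
  by exists (Edge 0 1), 0; rewrite !inE eqxx.
have [->|r1] := eqVneq r 1.
  by exists (Edge 0 1), 1; rewrite !inE eqxx.
have [->|r2] := eqVneq r w.-1.
  by exists (Edge w.-1 w./2.+1), w.-1; split; rewrite ?inE ?eqxx ?orbT.
have [->|r3] := eqVneq r w./2.
  exists (Edge w.-1 w./2.+1), (w.-1 + w./2.+1); split; rewrite ?inE ?eqxx ?orbT //.
  by rewrite (_ : _ + _ = w./2 + w) ?modnDr //; lia.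
have [|||||p [v [pP vp e]]] := @reflection_covers w 2 w./2.-2 r; try lia.
by exists p, v; rewrite !inE pP !orbT.
Qed.

Lemma tiled_affine M s b B P : s %| M -> s %| B -> coprime b s -> covers s P ->
  all (piece_ok M s) (map (affine b B) P) ->
  tiled M (flatten (map (diffs M) (map (affine b B) P))).
Proof.
move=> sM sB bs cP ok; apply: (@tiled_tile M s).
by rewrite /tile_ok sM ok; apply: covers_affine.
Qed.

Lemma diffs_reflection M B w a k :
  flatten (map (diffs M) (map (affine 1 B) (reflection w a k))) =
  [seq B + j.*2 | j <- iota a k].
Proof.
rewrite /reflection -!map_comp.
by elim: (iota a k) => //= j r ->; rewrite mul1n.
Qed.

Lemma ok_reflection M B s w a k : 0 < a -> (B + (a + k).*2 <= M./2.+1) -> ~~ odd M ->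
  all (piece_ok M s) (map (affine 1 B) (reflection w a k)).
Proof.
move=> a0 ak M_even; rewrite /reflection -!map_comp all_map; apply/allP => j.
by rewrite mem_iota /= mul1n => h; apply/andP; split; lia.
Qed.

Lemma uniq_evens B a k : uniq [seq B + j.*2 | j <- iota a k].
Proof. by rewrite map_inj_uniq ?iota_uniq // => x y /eqP; lia. Qed.

Lemma mem_evens B a k d :
  (d \in [seq B + j.*2 | j <- iota a k]) =
  [&& B + a.*2 <= d, d < B + (a + k).*2 & odd d == odd B].
Proof.
apply/mapP/and3P => [[j]|[h1 h2 /eqP h3]].
  by rewrite mem_iota => h ->; split; lia.
by exists ((d - B)./2); [rewrite mem_iota; lia | lia].
Qed.

(** Recovers the difference [2] lost when [4] divides the modulus: for odd [o] the vertices
    [0, o, o + 2, 2] are all the residues modulo 4. *)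
Lemma tiled_two_mod4 M B o : 4 %| M -> 4 %| B -> odd o -> 0 < B + o -> (B + o).*2 < M ->
  (B + 2).*2 < M -> tiled M [:: B + o; B + 2].
Proof.
move=> M4 B4 o_odd Bo BoM B2M.
have cov : covers 4 [:: Para 0 o 2].
  rewrite /covers /= !add0n -(modnDml o 2).
  by have [->|->] : o %% 4 = 1 \/ o %% 4 = 3 by lia.
have := tiled_affine M4 B4 (coprime1n 4) cov; rewrite /= !mul1n; apply.
by rewrite Bo BoM B2M addn2.
Qed.

Lemma tiled_block M B w : ~~ odd M -> ~~ odd w -> 0 < w -> w %| M -> w %| B ->
  (B + w).*2 <= M -> tiled M (iota B.+1 w.-1).
Proof.
move=> M_even w_even w0 wM wB BwM; have B_even : ~~ odd B.
  by case/dvdnP: wB => k ->; rewrite oddM negb_and w_even orbT.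
have fill L : uniq L -> {subset L <= iota B.+1 w.-1} -> 
    (forall d, ~~ odd d -> B < d < B + w -> d \in L) -> tiled M L ->
    tiled M (iota B.+1 w.-1).
  move=> uL Ls evs; apply: tiled_fill => //; first exact: iota_uniq.
  move=> d; rewrite mem_iota => dS dL.
  have dw : B < d < B + w by lia.
  by case: (boolP (odd d)) => [_|/evs/(_ dw)]; [lia|rewrite (negbTE dL)].
have [w2|w4] : w %% 4 = 2 \/ w %% 4 = 0 by lia.
  have := tiled_affine wM wB (coprime1n w) (reflection_mod4_2_covers w2).
  rewrite /= diffs_reflection mul1n ok_reflection //; last by lia.
  rewrite andbT => tL; apply: (fill) (tL _); last by lia.
  - by rewrite /= uniq_evens mem_evens; lia.
  - by move=> d; rewrite inE mem_evens mem_iota; lia.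
  - by move=> d d_even dB; rewrite inE mem_evens; lia.
have {}w4 : 4 %| w by lia.
have M4 : 4 %| M by apply: dvdn_trans wM.
have B4 : 4 %| B by apply: dvdn_trans wB.
have [w5|w5] := ltnP 4 w; last first.
  have w_eq4 : w = 4 by lia.
  apply: (fill [:: B + 1; B + 2]).
  - by rewrite /= !inE; lia.
  - by move=> d; rewrite !inE mem_iota; lia.
  - by move=> d; rewrite !inE; lia.
  - by apply: tiled_two_mod4 => //; lia.
have := tiled_affine wM wB (coprime1n w) (reflection_mod4_0_covers w4 w5).
rewrite /= diffs_reflection !mul1n => tL.
(* [B + 3] and [B + 2] form a parallelogram modulo 4; [B + 1] and [B + w / 2 + 1] belong to the
   edges at the fixed points. *)
apply: (fill ([:: B + 3; B + 2] ++ [:: B + 1, B + w./2.+1 & [seq B + j.*2 | j <- iota 2 w./2.-2]])).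
- have w8 : 7 < w by lia.
  rewrite /= !inE uniq_evens !mem_evens. lia.
- by move=> d; rewrite !inE mem_evens mem_iota; lia.
- by move=> d d_even dB; rewrite !inE mem_evens; lia.
apply: tiled_cat; first by apply: tiled_two_mod4 => //; lia.
by apply: tL; rewrite ok_reflection //; lia.
Qed.

(** The difference [M / 2] belongs to a [Loop]: for odd [w] it fills the fixed point of the
    reflection, for even [w] it is a tile modulo 1 by itself. *)
Lemma tiled_half_block M B w : ~~ odd M -> ~~ odd B -> 0 < w -> w %| B -> B + w = M./2 ->
  tiled M (iota B.+1 w).
Proof.
move=> M_even B_even w0 wB BwM.
have wM2 : w %| M./2 by rewrite -BwM dvdn_addr.
have wM : w %| M by rewrite (_ : M = M./2 + M./2) ?dvdn_add //; lia.
case: (boolP (odd w)) => [w_odd|w_even]; last first.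
  have -> : iota B.+1 w = iota B.+1 w.-1 ++ [:: M./2].
    by rewrite -{1}(subnK w0) iotaD subn1; congr (_ ++ [:: _]); lia.
  apply: tiled_cat; first by apply: tiled_block => //; lia.
  by apply: (@tiled_tile M 1 [:: Loop 0]); rewrite /tile_ok /= !dvd1n.
have := tiled_affine wM wB (coprime1n w) (reflection_odd_covers w_odd).
rewrite /= diffs_reflection ok_reflection //; last by lia.
move=> tL; apply: tiled_fill (tL _) => //; rewrite ?andbT //.
- by rewrite /= uniq_evens mem_evens; lia.
- exact: iota_uniq.
- by move=> d; rewrite inE mem_evens mem_iota; lia.
by move=> d; rewrite mem_iota inE mem_evens; lia.
Qed.

Lemma filter_ndvd_block m i k : 0 < k <= m ->
  [seq d <- iota (i * m) k | ~~ (m %| d)] = iota (i * m).+1 k.-1.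
Proof.
move=> /andP[k0 km]; case: k k0 km => // k _ km /=.
rewrite dvdn_mull //=; apply/all_filterP/allP => d; rewrite mem_iota => h.
have -> : d = d - i * m + i * m by lia.
by rewrite dvdn_addl ?dvdn_mull // gtnNdvd //; lia.
Qed.

Lemma tiled_blocks M m i : ~~ odd M -> ~~ odd m -> 0 < m -> m %| M ->
  (i * m).*2 <= M -> tiled M [seq d <- iota 0 (i * m) | ~~ (m %| d)].
Proof.
move=> M_even m_even m0 mM; elim: i => [|i IH] iM; first by exists [::].
rewrite mulSn addnC iotaD filter_cat add0n filter_ndvd_block ?m0 ?leqnn //.
apply: tiled_cat; first by apply: IH; lia.
by apply: tiled_block => //; [rewrite dvdn_mull | lia].
Qed.

Lemma filter_iota_pred m k :
  [seq d <- iota 1 k | ~~ (m %| d)] = [seq d <- iota 0 k.+1 | ~~ (m %| d)].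
Proof. by rewrite /= dvdn0. Qed.

(** The multiples of [m] cut the range into whole blocks, followed, when [q] is odd, by a half block
    of length [m / 2] ending at [M / 2]. *)
Lemma tiled_even M m q : ~~ odd m -> 0 < m -> 0 < q -> M = m * q ->
  tiled M [seq d <- iota 1 M./2 | ~~ (m %| d)].
Proof.
move=> m_even m0 q0 Mq; have M_even : ~~ odd M by rewrite Mq oddM negb_and m_even.
have mM : m %| M by rewrite Mq dvdn_mulr.
have tK i : (i * m).*2 <= M -> tiled M [seq d <- iota 0 (i * m) | ~~ (m %| d)].
  exact: tiled_blocks.
rewrite filter_iota_pred; case: (boolP (odd q)) => q_odd.
  have [w mw] : exists w, m = w.*2 by exists m./2; lia.
  have -> : M./2.+1 = q./2 * m + w.+1 by nia.
  rewrite iotaD filter_cat add0n filter_ndvd_block; last by lia.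
  apply: tiled_cat; first by apply: tK; nia.
  apply: tiled_half_block => //; rewrite ?oddM ?negb_and ?m_even ?orbT //; first by lia.
    by rewrite mw -muln2 mulnA mulnAC dvdn_mull.
  by nia.
have -> : M./2.+1 = q./2 * m + 1 by nia.
rewrite iotaD filter_cat add0n filter_ndvd_block ?m0 //= cats0.
by apply: tK; nia.
Qed.

(** * Tilings modulo twice an odd number *)

Lemma size_flatten_map2 (A B C : Type) (g : B -> seq C) (f : A -> seq B) k r :
  (forall x, size (flatten (map g (f x))) = k) ->
  size (flatten (map g (flatten [seq f x | x <- r]))) = k * size r.
Proof.
move=> h; elim: r => [|x r IH] /=; first by rewrite muln0.
by rewrite map_cat flatten_cat size_cat IH h mulnS.
Qed.

(* Even vertices are reflected in 0 and odd vertices in 1, so that every even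
   difference occurs twice up to sign. *)
Definition doubled (c : nat) : seq piece :=
  Edge 0 1 :: flatten [seq [:: Edge (c.*2 - x.*2) (4 * x); Edge x.*2.+1 (c.*2 - 4 * x)]
                         | x <- iota 1 c./2].

Lemma doubled_covers c : odd c -> covers c.*2 (doubled c).
Proof.
move=> c_odd; apply: covers_by => [|r rc].
  by rewrite /= (@size_flatten_map2 _ _ _ _ _ 4) // size_iota; lia.
have mem x p : 0 < x <= c./2 ->
    p \in [:: Edge (c.*2 - x.*2) (4 * x); Edge x.*2.+1 (c.*2 - 4 * x)] -> p \in doubled c.
  move=> hx px; rewrite inE; apply/orP; right; apply/flatten_mapP.
  by exists x; rewrite // mem_iota; lia.
have [->|r0] := eqVneq r 0; first by exists (Edge 0 1), 0; split; rewrite ?inE.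
have [->|r1] := eqVneq r 1; first by exists (Edge 0 1), 1; split; rewrite ?inE.
have [r_odd|r_even] := boolP (odd r).
  have [rc1|rc1] := ltnP r c.+1.
    exists (Edge (r./2).*2.+1 (c.*2 - 4 * r./2)), (r./2).*2.+1; split.
    - by apply: (mem r./2); rewrite ?inE ?eqxx ?orbT //; lia.
    - by rewrite !inE eqxx.
    - by congr modn; lia.
  pose x := (c.*2.+1 - r)./2.
  exists (Edge x.*2.+1 (c.*2 - 4 * x)), (x.*2.+1 + (c.*2 - 4 * x)); split.
  - by apply: (mem x); rewrite ?inE ?eqxx ?orbT // /x; lia.
  - by rewrite !inE eqxx orbT.
  - by congr modn; rewrite /x; lia.
have [rc1|rc1] := ltnP r c.
  pose x := r./2.
  exists (Edge (c.*2 - x.*2) (4 * x)), (c.*2 - x.*2 + 4 * x); split.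
  - by apply: (mem x); rewrite ?inE ?eqxx // /x; lia.
  - by rewrite !inE eqxx orbT.
  - by rewrite (_ : _ + _ = r + c.*2) ?modnDr // /x; lia.
pose x := (c.*2 - r)./2.
exists (Edge (c.*2 - x.*2) (4 * x)), (c.*2 - x.*2); split.
- by apply: (mem x); rewrite ?inE ?eqxx // /x; lia.
- by rewrite !inE eqxx.
- by congr modn; rewrite /x; lia.
Qed.

(** For odd [c > 1], these are the numbers congruent modulo [2 * c] to a difference of
    [doubled c]. *)
Definition in_doubled (c d : nat) : bool :=
  ~~ (c %| d) && (~~ odd d || (d %% c.*2 == 1)).

Lemma in_doubled_block c i e : odd c -> e < c.*2 ->
  in_doubled c (i * c.*2 + e) = (e == 1) && (1 < c) || (0 < e) && ~~ odd e.
Proof.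
move=> c_odd ec; rewrite /in_doubled modnMDl modn_small // oddD oddM odd_double andbF /=.
rewrite dvdn_addr; last by rewrite -muln2 mulnCA dvdn_mulr.
case: e ec => [|e] ec; first by rewrite dvdn0.
have [k|k] := boolP (odd e.+1).
  by have [->|e1] := eqVneq e.+1 1; rewrite ?dvdn1 ?andbT /=; lia.
have -> : c %| e.+1 = false; last by lia.
apply/negP => /dvdnP[[|[|q]] ek]; move: k; rewrite ek ?oddM ?c_odd; lia.
Qed.

Lemma tiled_doubled_block M c i : ~~ odd M -> odd c -> 1 < c -> c.*2 %| M ->
  (i.+1 * c.*2).*2 <= M ->
  tiled M [seq d <- iota (i * c.*2) c.*2 | in_doubled c d].
Proof.
move=> M_even c_odd c1 cM iM; set B := i * c.*2.
have cB : c.*2 %| B by rewrite dvdn_mull.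
have BM : (B + c.*2).*2 <= M by rewrite /B; lia.
have B_even : ~~ odd B by rewrite /B oddM odd_double andbF.
have := @tiled_affine M _ 1 B (doubled c) cM cB (coprime1n _) (doubled_covers c_odd).
move=> tL; apply: tiled_perm (tL _); last first.
  apply/allP => p /mapP[p' p'P ->]; move: p'P; rewrite inE.
  case/predU1P=> [->|/flatten_mapP[x]]; first by rewrite /=; lia.
  by rewrite mem_iota !inE => hx /orP[]/eqP-> /=; rewrite !mul1n; lia.
apply: (@perm_trans _ (B + 1 :: [seq B + j.*2 | j <- iota 1 c.-1])).
  rewrite perm_sym; apply: perm_by_size.
  - by rewrite /= uniq_evens mem_evens; lia.
  - move=> d; rewrite inE mem_evens => /predU1P[->|hd].
      by rewrite /= mul1n inE eqxx.
    (* Relative to [B], multiples of 4 are of the form [4 * x]; as [c] is odd, numbers congruent to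
       2 modulo 4 are of the form [2 * c - 4 * x]. *)
    have [x [hx dx]] : exists x, 0 < x <= c./2 /\
        d \in [:: B + 4 * x; B + (c.*2 - 4 * x)].
      clear tL cB BM cM iM M_even; rewrite -/B in hd; move: B B_even hd => b b_even hd.
      have [e de] : exists e, d = b + e by exists (d - b); lia.
      have [k|k] : e %% 4 = 0 \/ e %% 4 = 2 by lia.
        by exists (e %/ 4); rewrite !inE; lia.
      by exists ((c.*2 - e) %/ 4); rewrite !inE; lia.
    apply/flatten_mapP; move: dx; rewrite !inE => /orP[]/eqP->.
      exists (affine 1 B (Edge (c.*2 - x.*2) (4 * x))); last by rewrite /= mul1n inE.
      apply: map_f; rewrite inE; apply/orP; right; apply/flatten_mapP; exists x.
        by rewrite mem_iota; lia.
      by rewrite inE eqxx.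
    exists (affine 1 B (Edge x.*2.+1 (c.*2 - 4 * x))); last by rewrite /= mul1n inE.
    apply: map_f; rewrite inE; apply/orP; right; apply/flatten_mapP; exists x.
      by rewrite mem_iota; lia.
    by rewrite !inE eqxx orbT.
  - rewrite -map_comp /= (@size_flatten_map2 _ _ _ _ _ 2) // size_map !size_iota; lia.
apply: uniq_perm.
- by rewrite /= uniq_evens mem_evens; lia.
- by rewrite filter_uniq ?iota_uniq.
move=> d; rewrite mem_filter mem_iota inE mem_evens.
case: (boolP (B <= d < B + c.*2)) => [hd|]; last by lia.
have [e [-> ec]] : exists e, d = B + e /\ e < c.*2 by exists (d - B); lia.
rewrite andbT in_doubled_block // c1 andbT; clear -B_even ec; lia.
Qed.

Lemma tiled_doubled M c i : ~~ odd M -> odd c -> 1 < c -> c.*2 %| M ->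
  (i * c.*2).*2 <= M -> tiled M [seq d <- iota 0 (i * c.*2) | in_doubled c d].
Proof.
move=> M_even c_odd c1 cM; elim: i => [|i IH] iM; first by exists [::].
rewrite [i.+1 * _]mulSn addnC iotaD filter_cat add0n; apply: tiled_cat.
  by apply: IH; lia.
exact: tiled_doubled_block.
Qed.

(* Index the even vertices modulo [2 * c] by [x] when they are congruent to [x]
   modulo [c], and the odd vertices by [x] when they are congruent to [1 + x].  The
   indices [1, ..., c./2] are grouped in pairs [2 t - 1, 2 t]: even vertices of index
   [+- (2 t - 1)] and odd ones of index [+- 2 t] are matched by reflection, the others
   across, so that every even difference occurs only once.  An unpaired last index
   gives a parallelogram. *)
Definition single_quad (c t : nat) : seq piece :=
  [:: Edge (c.+1 - t.*2) (4 * t - 2); Edge (c.*2.+1 - t.*2) (4 * t);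
      Edge t.*2 (c.+2 - 4 * t); Edge (c + t.*2) (c - 4 * t)].

Definition single (c : nat) : seq piece :=
  flatten [seq single_quad c t | t <- iota 1 c./2./2] ++
  (if odd c./2 then [:: Para (c - c./2) 1 c.-1] else [::]).

Lemma mem_single_quad c t p :
  0 < t <= c./2./2 -> p \in single_quad c t -> p \in single c.
Proof.
move=> ht pt; rewrite mem_cat; apply/orP; left; apply/flatten_mapP.
by exists t; rewrite // mem_iota; lia.
Qed.

Lemma mem_single_para c : odd c./2 -> Para (c - c./2) 1 c.-1 \in single c.
Proof. by move=> h; rewrite mem_cat h inE eqxx orbT. Qed.

Lemma size_single (g : piece -> seq nat) c (k k' : nat) :
  (forall t, size (flatten (map g (single_quad c t))) = k) ->
  size (g (Para (c - c./2) 1 c.-1)) = k' ->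
  size (flatten (map g (single c))) = k * c./2./2 + k' * odd c./2.
Proof.
move=> hk hk'; rewrite map_cat flatten_cat size_cat (@size_flatten_map2 _ _ _ _ _ k) //.
by rewrite size_iota; case: odd; rewrite /= ?size_cat ?hk' /=; lia.
Qed.

Lemma single_covers c : odd c -> covers c.*2 (Edge 0 1 :: single c).
Proof.
move=> c_odd; apply: covers_by => [|r rc].
  by rewrite /= (@size_single _ _ 8 4) //; lia.
have hit t p v : 0 < t <= c./2./2 -> p \in single_quad c t -> v \in verts p ->
    v = r %[mod c.*2] -> exists p v,
    [/\ p \in Edge 0 1 :: single c, v \in verts p & v = r %[mod c.*2]].
  by move=> /mem_single_quad h /h pc vp e; exists p, v; rewrite inE pc orbT.
have hitp v : odd c./2 -> v \in verts (Para (c - c./2) 1 c.-1) ->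
    v = r %[mod c.*2] -> exists p v,
    [/\ p \in Edge 0 1 :: single c, v \in verts p & v = r %[mod c.*2]].
  move=> /mem_single_para pc vp e.
  by exists (Para (c - c./2) 1 c.-1), v; rewrite inE pc orbT.
have [->|r0] := eqVneq r 0; first by exists (Edge 0 1), 0; split; rewrite ?inE.
have [->|r1] := eqVneq r 1; first by exists (Edge 0 1), 1; split; rewrite ?inE.
have modeq v : v = r \/ v = r + c.*2 -> v = r %[mod c.*2].
  by case=> ->; rewrite ?modnDr.
(* Each parity splits into four ranges, one for each of the four vertices of that parity in
   [single_quad c t]; the exceptional equalities with [c./2] are the vertices of the
   parallelogram. *)
have [r_even|r_odd] := boolP (~~ odd r).
  have [rh|rh] := leqP r c./2.
    apply: (hit r./2 (Edge r (c.+2 - 4 * r./2)) r); rewrite ?inE ?eqxx //; try lia.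
    by apply/or4P/Or43/eqP; congr Edge; lia.
  have [rm|rm] := ltnP r c.
    have [e|e] := eqVneq (c - r) c./2.
      by apply: (hitp (c - c./2)); rewrite ?inE ?eqxx //; [lia | apply: modeq; lia].
    pose t := (c.+1 - r)./2.
    apply: (hit t (Edge (c.+1 - t.*2) (4 * t - 2)) (c.+1 - t.*2)); rewrite ?inE ?eqxx //.
      by rewrite /t; lia.
    by apply: modeq; rewrite /t; lia.
  have [rh'|rh'] := leqP (r - c) c./2.
    have [e|e] := eqVneq (r - c) c./2.
      apply: (hitp (c - c./2 + c.-1)); rewrite ?inE ?eqxx ?orbT //; first lia.
      by apply: modeq; lia.
    pose t := (r.+1 - c)./2.
    apply: (hit t (Edge (c.+1 - t.*2) (4 * t - 2)) (c.+1 - t.*2 + (4 * t - 2)));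
      rewrite ?inE ?eqxx ?orbT //; first by rewrite /t; lia.
    by apply: modeq; rewrite /t; lia.
  pose t := (c.*2 - r)./2.
  apply: (hit t (Edge (c + t.*2) (c - 4 * t)) (c + t.*2 + (c - 4 * t)));
    rewrite ?inE ?eqxx ?orbT //; first by rewrite /t; lia.
  by apply: modeq; rewrite /t; lia.
have {}r_odd : odd r by rewrite negbK in r_odd.
have [rh|rh] := leqP r c./2.+1.
  pose t := r./2.
  apply: (hit t (Edge (c.*2.+1 - t.*2) (4 * t)) (c.*2.+1 - t.*2 + 4 * t));
    rewrite ?inE ?eqxx ?orbT //; first by rewrite /t; lia.
  by apply: modeq; rewrite /t; lia.
have [rm|rm] := leqP r c.
  have [e|e] := eqVneq (c.+1 - r) c./2.
    apply: (hitp (c - c./2 + 1)); rewrite ?inE ?eqxx ?orbT //; first lia.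
    by apply: modeq; lia.
  pose t := (c.+2 - r)./2.
  apply: (hit t (Edge t.*2 (c.+2 - 4 * t)) (t.*2 + (c.+2 - 4 * t)));
    rewrite ?inE ?eqxx ?orbT //; first by rewrite /t; lia.
  by apply: modeq; rewrite /t; lia.
have [rh'|rh'] := leqP (r - c.+1) c./2.
  have [e|e] := eqVneq (r - c.+1) c./2.
    apply: (hitp (c - c./2 + 1 + c.-1)); rewrite ?inE ?eqxx ?orbT //; first lia.
    by apply: modeq; lia.
  pose t := (r - c)./2.
  apply: (hit t (Edge (c + t.*2) (c - 4 * t)) (c + t.*2)); rewrite ?inE ?eqxx ?orbT //.
    by rewrite /t; lia.
  by apply: modeq; rewrite /t; lia.
pose t := (c.*2.+1 - r)./2.
apply: (hit t (Edge (c.*2.+1 - t.*2) (4 * t)) (c.*2.+1 - t.*2));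
  rewrite ?inE ?eqxx ?orbT //; first by rewrite /t; lia.
by apply: modeq; rewrite /t; lia.
Qed.

Definition is_loop (p : piece) : bool := if p is Loop _ then true else false.

(** Used because [affine] does not act on the difference of a [Loop]. *)
Lemma single_no_loop c p : p \in single c -> ~~ is_loop p.
Proof.
rewrite mem_cat => /orP[/flatten_mapP[t _]|].
  by rewrite !inE => /or4P[]/eqP->.
by case: odd => //; rewrite inE => /eqP->.
Qed.

(** Even differences are [4 * t - 2] and [4 * t], odd ones [c + 2 - 4 * t] and [c - 4 * t]. When
    [c./2] is odd these miss exactly [1] and [c - 1], the differences of the parallelogram. *)
Lemma perm_diffs_single M c : odd c -> 0 < c ->
  perm_eq (iota 1 c.-1) (flatten (map (diffs M) (single c))).
Proof.
move=> c_odd c0; apply: perm_by_size; first exact: iota_uniq.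
  move=> d; rewrite mem_iota => hd.
  have hit t p : 0 < t <= c./2./2 -> p \in single_quad c t -> d \in diffs M p ->
      d \in flatten (map (diffs M) (single c)).
    by move=> ht pt dp; apply/flatten_mapP; exists p => //; apply: mem_single_quad pt.
  have hitp : odd c./2 -> d \in [:: 1; c.-1] ->
      d \in flatten (map (diffs M) (single c)).
    by move=> /mem_single_para pc dp; apply/flatten_mapP; exists (Para (c - c./2) 1 c.-1).
  have [e|[t [ht]]] : (odd c./2 /\ d \in [:: 1; c.-1]) \/ exists t, 0 < t <= c./2./2 /\
      [\/ d = 4 * t - 2, d = 4 * t, d = c.+2 - 4 * t | d = c - 4 * t].
    have [e|e] := boolP (odd c./2 && (d \in [:: 1; c.-1])); first by left; apply/andP.
    right; rewrite !inE in e.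
    have [k|[k|[[k k']|[k k']]]] : d %% 4 = 2 \/ d %% 4 = 0 \/
        (odd d /\ (c - d) %% 4 = 2) \/ (odd d /\ (c - d) %% 4 = 0) by lia.
    - by exists (d %/ 4).+1; split; [lia | constructor 1; lia].
    - by exists (d %/ 4); split; [lia | constructor 2; lia].
    - by exists ((c - d) %/ 4).+1; split; [lia | constructor 3; lia].
    - by exists ((c - d) %/ 4); split; [lia | constructor 4; lia].
  - by case: e => e1 e2; apply: hitp.
  case=> de.
  - by apply: (hit t (Edge (c.+1 - t.*2) (4 * t - 2))); rewrite ?inE ?eqxx ?de.
  - by apply: (hit t (Edge (c.*2.+1 - t.*2) (4 * t))); rewrite ?inE ?eqxx ?de ?orbT.
  - by apply: (hit t (Edge t.*2 (c.+2 - 4 * t))); rewrite ?inE ?eqxx ?de ?orbT.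
  - by apply: (hit t (Edge (c + t.*2) (c - 4 * t))); rewrite ?inE ?eqxx ?de ?orbT.
by rewrite (@size_single _ _ 4 2) // size_iota; lia.
Qed.

Lemma tiled_single M c b B v : ~~ odd M -> odd c -> 1 < c -> c.*2 %| M -> c.*2 %| B ->
  coprime b c.*2 -> 0 < b -> (B + b * c).*2 <= M -> 0 < v -> v.*2 < M ->
  v = b %[mod c.*2] \/ v + b = 0 %[mod c.*2] ->
  tiled M (v :: [seq B + b * j | j <- iota 1 c.-1]).
Proof.
move=> M_even c_odd c1 cM cB bc b0 BbM v0 vM vb; have c0 := ltnW c1.
have diffsE : flatten (map (diffs M) (map (affine b B) (single c))) =
    [seq B + b * j | j <- flatten (map (diffs M) (single c))].
  rewrite map_flatten -!map_comp; congr flatten; apply/eq_in_map => p /single_no_loop.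
  by case: p.
apply: (@tiled_perm _ (v :: flatten (map (diffs M) (map (affine b B) (single c))))).
  rewrite perm_cons diffsE; apply: perm_map.
  by rewrite perm_sym; apply: perm_diffs_single.
have [x cov] : exists x, covers c.*2 (Edge x v :: map (affine b B) (single c)).
  have := covers_affine bc cB (single_covers c_odd); rewrite /covers /=.
  have -> : (b * 0 + (B + b * 1)) %% c.*2 = b %% c.*2.
    by rewrite muln0 add0n muln1 -modnDml (eqP cB).
  rewrite muln0 => cov; case: vb => vb; [exists 0 | exists b]; first by rewrite add0n vb.
  rewrite [b + v]addnC vb; apply: perm_trans cov.
  exact: (permEl (perm_catCA [:: b %% c.*2] [:: 0 %% c.*2] _)).
suff ok : tile_ok M (c.*2, Edge x v :: map (affine b B) (single c)).
  exact: (tiled_tile ok).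
rewrite /tile_ok cM -/(covers _ _) cov /= v0 vM andbT.
apply/allP => p /mapP[p' p'c ->].
have ds d : d \in diffs M p' -> 0 < d < c.
  move=> dp; have : d \in iota 1 c.-1.
    rewrite (perm_mem (perm_diffs_single M c_odd c0)); apply/flattenP.
    by exists (diffs M p') => //; apply: map_f.
  by rewrite mem_iota add1n prednK.
have bound d : d \in diffs M p' -> (0 < B + b * d) && ((B + b * d).*2 < M).
  move/ds/andP=> [d0 dc]; have bdc : b * d < b * c by rewrite ltn_pmul2l.
  have bd0 : 0 < b * d by rewrite muln_gt0 b0.
  rewrite ltn_addl //=; apply: leq_trans BbM.
  by rewrite ltn_double ltn_add2l.
case: p' {ds} p'c bound => [y d|y d e|y] p'c bound /=.
- by apply: bound; rewrite inE.
- by rewrite andbA !bound // !inE eqxx ?orbT.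
- by have := single_no_loop p'c.
Qed.

(* Up to [K * m.*2 + m], every even number not divisible by [m] is listed;
   [m.*2.-1] supplies the extra odd difference needed by [tiled_single]. *)
Definition core (m K : nat) : seq nat :=
  [seq d <- iota 0 (K * m.*2) | in_doubled m d] ++
  m.*2.-1 :: [seq K * m.*2 + j | j <- iota 1 m.-1].

Lemma mem_core m K d : (d \in core m K) =
  [|| (d < K * m.*2) && in_doubled m d, d == m.*2.-1 |
      K * m.*2 < d < K * m.*2 + m].
Proof.
rewrite mem_cat mem_filter mem_iota inE andbC /=; congr [|| _, _ | _].
apply/mapP/idP => [[j]|h]; first by rewrite mem_iota => h ->; lia.
by exists (d - K * m.*2); rewrite ?mem_iota; lia.
Qed.

Lemma uniq_core m K : 1 < m -> 0 < K -> uniq (core m K).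
Proof.
move=> m1 K0; have Km : m.*2 <= K * m.*2 by rewrite leq_pmull.
have n1 : ~~ in_doubled m m.*2.-1.
  by rewrite /in_doubled modn_small ?negb_and ?negb_or; lia.
rewrite cat_uniq filter_uniq ?iota_uniq //= map_inj_uniq ?iota_uniq ?andbT; last first.
  by move=> x y /eqP; rewrite eqn_add2l => /eqP.
rewrite negb_or mem_filter (negbTE n1) /=; move: (K * m.*2) Km => B Km.
apply/andP; split.
  by apply/hasP => -[d /mapP[j]]; rewrite mem_iota => hj ->; rewrite mem_filter mem_iota; lia.
by apply/mapP => -[j]; rewrite mem_iota; lia.
Qed.

Lemma tiled_core M m K : ~~ odd M -> odd m -> 1 < m -> 0 < K -> m.*2 %| M ->
  (K * m.*2 + m).*2 <= M -> tiled M (core m K).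
Proof.
move=> M_even m_odd m1 K0 mM KM; have Km : m.*2 <= K * m.*2 by rewrite leq_pmull.
apply: tiled_cat.
  by apply: tiled_doubled => //; apply: leq_trans KM; rewrite leq_double leq_addr.
have -> : [seq K * m.*2 + j | j <- iota 1 m.-1] = [seq K * m.*2 + 1 * j | j <- iota 1 m.-1].
  by apply: eq_map => j; rewrite mul1n.
apply: tiled_single; rewrite ?coprime1n ?dvdn_mull ?mul1n //.
- by move: (K * m.*2) Km KM => B; lia.
- by move: (K * m.*2) Km KM => B; lia.
by right; rewrite addn1 prednK ?modnn ?mod0n //; lia.
Qed.

Lemma core_ndvd m K d : odd m -> 1 < m -> d \in core m K -> ~~ (m %| d).
Proof.
move=> m_odd m1; rewrite mem_core => /or3P[/andP[_ /andP[]//]|/eqP->|h].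
  apply/negP => h; have : m %| m.*2.-1.+1 by rewrite prednK; [rewrite -addnn dvdn_addr | lia].
  by rewrite -addn1 dvdn_addr // dvdn1; lia.
have -> : d = K * m.*2 + (d - K * m.*2) by move: (K * _) h => B; lia.
rewrite dvdn_addr; last by rewrite -muln2 mulnCA dvdn_mulr.
by rewrite gtnNdvd //; move: (K * _) h => B; lia.
Qed.

(** [M / 2 = m * k] consists of blocks of length [2 * m], followed for odd [k] by a half block,
    where [core] is used; [k > 1] then gives a whole block to take [2 * m - 1] from. *)
Lemma tiled_odd_parts M m k : odd m -> 1 < m -> 1 < k -> M = m.*2 * k ->
  tiled M [seq d <- iota 1 M./2 | ~~ (m %| d)].
Proof.
move=> m_odd m1 k1 Mk; have M_even : ~~ odd M by rewrite Mk oddM odd_double.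
have mM : m.*2 %| M by rewrite Mk dvdn_mulr.
have M2 : M./2 = m * k by rewrite Mk -doubleMl doubleK.
have mM2 : m %| M./2 by rewrite M2 dvdn_mulr.
have fill L : uniq L -> {in L, forall d, d <= M./2 /\ ~~ (m %| d)} ->
    (forall d, ~~ odd d -> ~~ (m %| d) -> d < M./2 -> d \in L) -> tiled M L ->
    tiled M [seq d <- iota 1 M./2 | ~~ (m %| d)].
  move=> uL Lok evs; apply: tiled_fill => //; first by rewrite filter_uniq ?iota_uniq.
    move=> d /Lok[dM md]; rewrite mem_filter md mem_iota.
    by case: d md dM => [|d]; rewrite ?dvdn0 // add1n ltnS.
  move=> d; rewrite mem_filter mem_iota => /andP[md hd] dL.
  have dM : d != M./2 by apply: contraNneq md => ->.
  have {hd dM} dM : d < M./2 by rewrite ltn_neqAle dM; case/andP: hd.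
  case: (boolP (odd d)) => [_|/evs/(_ md dM) h]; last by rewrite h in dL.
  by clear -dM; lia.
have [k_odd|k_even] := boolP (odd k); last first.
  have E : M./2 = k./2 * m.*2 by rewrite M2 -doubleMr doubleMl mulnC even_halfK.
  apply: (fill [seq d <- iota 0 (k./2 * m.*2) | in_doubled m d]).
  - by rewrite filter_uniq ?iota_uniq.
  - move=> d; rewrite mem_filter mem_iota -E => /andP[/andP[md _]] /andP[_ h].
    by split=> //; apply: ltnW.
  - by move=> d de md dM; rewrite mem_filter mem_iota -E /in_doubled md de.
  - by apply: tiled_doubled => //; rewrite -E; clear; lia.
have E : M./2 = k./2 * m.*2 + m.
  by rewrite M2 -{1}(odd_double_half k) k_odd mulnDr muln1 addnC -!muln2; congr (_ + _); lia.
have k2 : 0 < k./2 by clear -k1; lia.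
have Km : m.*2 <= k./2 * m.*2 by rewrite leq_pmull.
apply: (fill (core m k./2)).
- exact: uniq_core.
- move=> d dc; split; last exact: core_ndvd dc.
  by move: dc; rewrite mem_core E; move: (k./2 * _) Km => B; clear; lia.
- move=> d de md dM; rewrite mem_core /in_doubled md de /=.
  have dK : d != k./2 * m.*2.
    by apply: contraNneq md => ->; rewrite -muln2 mulnCA dvdn_mulr.
  by move: dM dK; rewrite E; move: (k./2 * _) => B; clear; lia.
- by apply: tiled_core => //; rewrite -E; clear; lia.
Qed.

(** Provides the extra odd difference for the tiling modulo [2 * a] with multiplier [b]. The bounds
    and [v != b] keep it apart from the multiples of [b] and from [1] and [2 * b - 1], which
    [core b] uses. One of [b + 2 * a], [4 * a - b], [2 * a - b] lies in range. *)
Lemma crt_extra a b : odd a -> odd b -> 1 < a -> a < b -> exists v,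
  [/\ odd v, 2 < v, v < b.*2.-2, v != b & v = b %[mod a.*2] \/ v + b = 0 %[mod a.*2]].
Proof.
move=> a_odd b_odd a1 ab; have [h|h] := leqP (a.*2 + 3) b.
  exists (b + a.*2); split; try lia.
  by left; rewrite modnDr.
have [h'|h'] := leqP (4 * a + 3) (3 * b).
  exists (4 * a - b); split; try lia.
  by right; rewrite (_ : _ + b = 2 * a.*2) ?modnMl ?mod0n //; lia.
exists (a.*2 - b); split; try lia.
by right; rewrite subnK ?modnn ?mod0n //; lia.
Qed.

Lemma tiled_coprime M a b : odd a -> odd b -> 1 < a -> a < b -> coprime a b ->
  M = (a * b).*2 -> tiled M [seq d <- iota 1 M./2 | ~~ (a * b %| d)].
Proof.
move=> a_odd b_odd a1 ab ab_cop Mab; have M_even : ~~ odd M by rewrite Mab odd_double.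
have M2 : M./2 = a * b by rewrite Mab doubleK.
have b1 : 1 < b by apply: ltn_trans ab.
have a2 : 0 < a./2 by clear -a1; lia.
have E : M./2 = a./2 * b.*2 + b.
  by rewrite M2 -{1}(odd_double_half a) a_odd mulnDl mul1n addnC -doubleMl -doubleMr.
have Kb : b.*2 <= a./2 * b.*2 by rewrite leq_pmull.
have [v [v_odd v2 vb vneb vmod]] := crt_extra a_odd b_odd a1 ab.
have bv : ~~ (b %| v).
  by apply/negP => /dvdnP[[|[|q]] qv]; move: v2 vb vneb; rewrite qv; clear; lia.
have vc : v \notin core b a./2.
  rewrite mem_core /in_doubled bv v_odd modn_small; last by clear -vb; lia.
  by move: (a./2 * _) Kb => B; clear -v2 vb; lia.
have b2M : b.*2 %| M by rewrite Mab doubleMr dvdn_mull.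
have a2M : a.*2 %| M by rewrite Mab doubleMl dvdn_mulr.
have EM : (a./2 * b.*2 + b).*2 = M by rewrite -E; clear -M_even; lia.
have cM d : d \in core b a./2 -> d < M./2.
  by rewrite mem_core E; move: (a./2 * _) Kb => B; clear -b1; lia.
(* [core] contains the even differences prime to the second family, that is, not divisible by [b];
   the last list consists of all multiples of [b] between [1] and [M / 2 - 1]. *)
apply: (@tiled_fill _ (core b a./2 ++ v :: [seq 0 + b * j | j <- iota 1 a.-1])) => //.
- rewrite cat_uniq uniq_core //= negb_or vc map_inj_uniq ?iota_uniq ?andbT; last first.
    by move=> x y /eqP; rewrite !add0n eqn_pmul2l => [/eqP//|]; apply: ltnW.
  apply/andP; split.
    apply/hasPn => d /mapP[j _ ->]; apply/negP => /(core_ndvd b_odd b1).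
    by rewrite add0n dvdn_mulr.
  by apply/negP => /mapP[j _ vj]; rewrite vj add0n dvdn_mulr in bv.
- by rewrite filter_uniq ?iota_uniq.
- move=> d; rewrite mem_cat inE mem_filter mem_iota -M2 => dL.
  have [d0 dM] : 0 < d /\ d < M./2.
    case/or3P: dL => [dc|/eqP->|/mapP[j]].
    - split; last exact: cM.
      by case: d dc => // /(core_ndvd b_odd b1); rewrite dvdn0.
    - by split; rewrite ?E; move: (a./2 * _) Kb => B; clear -v2 vb; lia.
    rewrite mem_iota add0n M2 => /andP[j0 ja] ->; rewrite muln_gt0 (ltnW b1) j0.
    by rewrite mulnC ltn_pmul2r ?(ltnW b1) //; move: ja; clear -a1; lia.
  by rewrite gtnNdvd // d0 add1n ltnS ltnW.
- move=> d; rewrite mem_filter mem_iota mem_cat inE mem_core -M2 => /andP[hd hM] dL.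
  have dM2 : d != M./2 by apply: contraNneq hd => ->.
  have {dM2} dM : d < M./2.
    by rewrite ltn_neqAle dM2; move: hM; rewrite add1n ltnS => /andP[].
  case: (boolP (odd d)) dL => [_ _|de]; first by move: dM; clear; lia.
  rewrite /in_doubled de; case: (boolP (b %| d)) => [/dvdnP[j dj]|bd] /=; last first.
    have : d != a./2 * b.*2.
      by apply: contraNneq bd => ->; rewrite -muln2 mulnCA dvdn_mulr.
    by move: dM; rewrite E; move: (a./2 * _) => B; clear; lia.
  rewrite !negb_or => /and3P[_ _ /mapP[]]; exists j; last by rewrite add0n mulnC.
  rewrite mem_iota; move: hM dM; rewrite M2 dj ltn_pmul2r ?(ltnW b1) //.
  by case: j {dj} => [|j]; rewrite ?mul0n // => _; clear -a1; lia.
apply: tiled_cat; first by apply: tiled_core; rewrite ?EM.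
apply: tiled_single => //; try by [apply: ltnW].
- by rewrite -muln2 coprimeMr coprimen2 b_odd andbT coprime_sym.
- by rewrite add0n mulnC Mab.
- by move: v2; clear; lia.
- by rewrite -EM; move: (a./2 * _) Kb => B; clear -vb; lia.
Qed.

Lemma coprime_split m : odd m -> 1 < m -> (forall p a, prime p -> m <> p ^ a.+1) ->
  exists a b, [/\ 1 < a, a < b, coprime a b & m = a * b].
Proof.
move=> m_odd m1 mp; have m0 := ltnW m1; have pp := pdiv_prime m1.
(* Split off the full power of the least prime factor; the cofactor exceeds 1 since [m] is not a
   prime power. *)
pose p := pdiv m; pose a := m`_p; pose b := m`_p^'.
have ab : m = a * b by rewrite /a /b partnC.
have ab_cop : coprime a b by rewrite coprime_partC.
have a1 : 1 < a by rewrite p_part_gt1 mem_primes pp m0 pdiv_dvd.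
have b1 : 1 < b.
  rewrite ltn_neqAle part_gt0 andbT eq_sym; apply/negP => /eqP b1.
  have am : m = p ^ logn p m by rewrite {1}ab b1 muln1 /a p_part.
  have lm : 0 < logn p m by rewrite logn_gt0 mem_primes pp m0 pdiv_dvd.
  by apply: (mp p (logn p m).-1 pp); rewrite prednK.
have [ltab|ltba|eab] := ltngtP a b.
- by exists a, b.
- by exists b, a; rewrite coprime_sym mulnC.
by move: ab_cop; rewrite eab /coprime gcdnn => /eqP e; rewrite e in b1.
Qed.

(** * Existence of the factorization *)

Lemma mem_part_subgroup m n (x : 'Z_(m * n)) :
  1 < m * n -> (x \in part_subgroup m n) = (m %| val x).
Proof.
move=> mn1; apply/imsetP/idP => [[y _ ->]|/dvdnP[k xk]].
  have mN : m %| (Zp_trunc (m * n)).+2 by rewrite Zp_cast // dvdn_mulr.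
  by rewrite Zp_mulrn /= /dvdn modn_dvdm // modnMl.
exists k%:R%R => //; apply: val_inj; rewrite -mulrnA /= val_Zp_nat // -xk.
by rewrite modn_small // -[X in _ < X](Zp_cast mn1) ltn_ord.
Qed.

Lemma tiled_exists m n M : 1 < m * n -> m * n = M.*2 -> ~~ odd M -> m %| M ->
  tiled M [seq d <- iota 1 M./2 | ~~ (m %| d)] ->
  exists Fs : {set {set {set {set 'Z_(m * n)}}}},
     is_cycle_factorization (Kmn m n) 4 Fs /\ is_cyclic Fs.
Proof.
move=> mn1 mnM M_even mM [T T_ok T_diffs]; have M0 : 0 < M by lia.
apply: (tiles_cyclic_factorization M_even M0 mnM mM T_ok T_diffs) => x y.
rewrite -(nonmultN M0 mnM mM) opprB.
by rewrite -[LHS]/((x - y)%R \notin part_subgroup m n) mem_part_subgroup.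
Qed.

Lemma sufficiency m n (hm : 1 < m) (hn : 1 < n) :
  (~~ odd m /\ ~~ odd n) \/
  [/\ odd m, n = 0 %[mod 4] &
      ~ (exists p a : nat, [/\ prime p, 1 <= a & (m, n) = (p ^ a, 4)])] ->
  exists Fs : {set {set {set {set 'Z_(m * n)}}}},
     is_cycle_factorization (Kmn m n) 4 Fs /\ is_cyclic Fs.
Proof.
have mn1 : 1 < m * n by apply: leq_trans hm _; rewrite leq_pmulr // ltnW.
case=> [[m_even n_even]|[m_odd /eqP n4 npow]].
  have nE : n = n./2.*2 by rewrite even_halfK.
  apply: (@tiled_exists m n (m * n./2)) => //.
  - by rewrite doubleMr -nE.
  - by rewrite oddM negb_and m_even.
  - exact: dvdn_mulr.
  - by apply: (@tiled_even _ m n./2) => //; clear -hm hn; lia.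
have /dvdnP[k nk] : 4 %| n by rewrite /dvdn (eqP n4).
have mnM : m * n = (m.*2 * k).*2.
  by rewrite nk -!muln2 -!mulnA; congr (_ * _); rewrite !mulnA mulnC; lia.
have M_even : ~~ odd (m.*2 * k) by rewrite oddM odd_double.
have mM : m %| m.*2 * k by rewrite -muln2 -mulnA dvdn_mulr.
apply: (tiled_exists mn1 mnM M_even mM).
have [k1|k1] := ltnP 1 k; first exact: (@tiled_odd_parts _ m k).
have {}k1 : k = 1 by clear -k1 nk hn; lia.
subst k; have [|a [b [a1 ab ab_cop mab]]] := @coprime_split m m_odd hm.
  by move=> p a p_pr mp; apply: npow; exists p, a.+1; rewrite -mp nk.
have := m_odd; rewrite {1}mab oddM => /andP[a_odd b_odd].
have -> : [seq d <- iota 1 (m.*2 * 1)./2 | ~~ (m %| d)] =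
    [seq d <- iota 1 (m.*2 * 1)./2 | ~~ (a * b %| d)] by rewrite -mab.
by apply: tiled_coprime => //; rewrite muln1 mab.
Qed.

(** * Necessity *)

(** As the length exceeds 2, going two steps along the cycle never returns, so distinct vertices [x]
    give distinct edges [{x, next x}] and the cycle has four vertices. *)
Lemma cycle_quad (V : finType) (e : rel V) (C : {set {set V}}) :
  is_cycle e C -> #|C| = 4 -> exists a b c d,
  [/\ uniq [:: a; b; c; d], [&& e a b, e b c, e c d & e d a] & C = quad a b c d].
Proof.
case=> s [s3 /andP[es us] ->] card4.
have nextK x : x \in s -> next s (next s x) != x.
  move=> xs; have [i p ip] := rot_to xs.
  have ur : uniq (rot i s) by rewrite rot_uniq.
  rewrite -!(next_rot i us) ip; move: ur s3; rewrite -(size_rot i) ip.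
  case: p {ip} => [|y [|z p]] //= /and3P[]; rewrite !inE !negb_or.
  move=> /and3P[xy xz _] /andP[yz _] _ _; rewrite !eqxx.
  by rewrite (eq_sym y) (negbTE xy) ?eqxx eq_sym.
have inj : {in s &, injective (fun x => [set x; next s x])}.
  move=> x y xs ys /set2_inj[[]//|[xy yx]].
  by have := nextK x xs; rewrite yx -xy eqxx.
have s4 : size s = 4.
  by rewrite -card4 /cycle_edges card_in_imset // (card_uniqP us).
case: s us es s4 {s3 nextK inj card4} => [|a [|b [|c [|d []]]]] //= us es _.
exists a, b, c, d; split=> //; first by move: es; rewrite andbT.
exact: quad_cycle_edges.
Qed.

Lemma quad_vertex (V : finType) (e : rel V) (a b c d x : V) :
  uniq [:: a; b; c; d] -> [&& e a b, e b c, e c d & e d a] ->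
  x \in cover (quad a b c d) -> exists b' c' d',
  [/\ uniq [:: x; b'; c'; d'], [&& e x b', e b' c', e c' d' & e d' x] &
      quad a b c d = quad x b' c' d'].
Proof.
move=> u /and4P[h1 h2 h3 h4]; rewrite cover_quad !inE -!orbA => /or4P[]/eqP->.
- by exists b, c, d; rewrite u h1 h2 h3 h4.
- exists c, d, a; rewrite h1 h2 h3 h4 quad_rot; split=> //.
  by move: u; rewrite -(rot_uniq 1).
- exists d, a, b; rewrite h1 h2 h3 h4 2!quad_rot; split=> //.
  by move: u; rewrite -(rot_uniq 2).
- exists a, b, c; rewrite h1 h2 h3 h4 3!quad_rot; split=> //.
  by move: u; rewrite -(rot_uniq 3).
Qed.

Section TwoFactor.

Variables (V : finType) (e : rel V) (F : {set {set {set V}}}).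
Hypotheses (F_2factor : is_2factor e F) (F_card4 : forall C, C \in F -> #|C| = 4).

Lemma factor_cycle C x : C \in F -> x \in cover C -> exists b c d,
  [/\ uniq [:: x; b; c; d], [&& e x b, e b c, e c d & e d x] & C = quad x b c d].
Proof.
move=> CF; have [a [b [c [d [u h ->]]]]] := cycle_quad (F_2factor.1 C CF) (F_card4 CF).
exact: quad_vertex.
Qed.

Lemma factor_cycle_ex x : exists2 C, C \in F & x \in cover C.
Proof.
have /eqP/cards1P[C hC] := F_2factor.2 x.
by exists C; have := set11 C; rewrite -hC inE => /andP[].
Qed.

Lemma factor_cycle_uniq x C C' :
  C \in F -> C' \in F -> x \in cover C -> x \in cover C' -> C = C'.
Proof.
move=> CF C'F xC xC'; have /eqP/cards1P[C0 hC] := F_2factor.2 x.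
have : C \in [set C0] by rewrite -hC inE CF.
have : C' \in [set C0] by rewrite -hC inE C'F.
by rewrite !inE => /eqP-> /eqP->.
Qed.

Lemma card_cover_cycle C : C \in F -> #|cover C| = 4.
Proof.
move=> CF; have [a [b [c [d [u _ ->]]]]] := cycle_quad (F_2factor.1 C CF) (F_card4 CF).
have -> : cover (quad a b c d) = [set x in [:: a; b; c; d]].
  by apply/setP=> x; rewrite cover_quad !inE -!orbA.
by rewrite cardsE (card_uniqP u).
Qed.

Lemma card_factor : #|V| = 4 * #|F|.
Proof.
transitivity (\sum_(x : V) \sum_(C in F | x \in cover C) 1).
  rewrite -sum1_card; apply: eq_bigr => x _; rewrite -[LHS](F_2factor.2 x) -sum1_card.
  by apply: eq_bigl => C; rewrite inE.
rewrite (exchange_big_dep (mem F)) /=; last by move=> x C _ /andP[].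
transitivity (\sum_(C in F) 4); last by rewrite sum_nat_const mulnC.
apply: eq_bigr => C CF; rewrite -(card_cover_cycle CF) -sum1_card.
by apply: eq_bigl => x; rewrite CF.
Qed.

Lemma card_factor_nbrs x : (forall a b, e a b = e b a) ->
  #|[set y | e x y && ([set x; y] \in cover F)]| = 2.
Proof.
move=> e_sym; have [C CF xC] := factor_cycle_ex x.
have [b [c [d [u /and4P[xb _ _ dx] CE]]]] := factor_cycle CF xC.
have -> : [set y | e x y && ([set x; y] \in cover F)] = [set b; d].
  apply/setP=> y; rewrite !inE; apply/andP/orP => [[_ /bigcupP[C' C'F xy]]|].
    have eC : C' = C.
      apply: (factor_cycle_uniq C'F CF _ xC).
      by apply/bigcupP; exists [set x; y]; rewrite // !inE eqxx.
    move: xy u; rewrite eC CE !inE /= !inE !negb_or -!orbA.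
    case/or4P=> /eqP/set2_inj[[h1 h2]|[h1 h2]];
      rewrite ?h1 ?h2 ?eqxx ?andbF //=; auto.
  case=> /eqP->; split=> //; rewrite 1?e_sym //; apply/bigcupP; exists C => //;
  by rewrite CE !inE ?eqxx // [[set x; d]]setUC eqxx ?orbT.
rewrite cards2; suff -> : b != d by [].
by move: u => /= /and4P[_]; rewrite !inE !negb_or => /andP[].
Qed.

End TwoFactor.

(** Double counting of the neighbours [y] and the factors through [{x, y}]: each factor contributes
    two neighbours. *)
Lemma card_nbrs (V : finType) (e : rel V) Fs x : (forall a b, e a b = e b a) ->
  is_cycle_factorization e 4 Fs -> #|[set y | e x y]| = 2 * #|Fs|.
Proof.
move=> e_sym [[F2 E1] F4].
transitivity (\sum_(y | e x y) \sum_(F in Fs | [set x; y] \in cover F) 1).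
  rewrite -sum1_card (eq_bigl (e x)); last by move=> y; rewrite inE.
  apply: eq_bigr => y xy; rewrite -[LHS](E1 [set x; y]).
    by rewrite -sum1_card; apply: eq_bigl => F; rewrite inE.
  by rewrite inE; apply/existsP; exists x; apply/existsP; exists y; rewrite xy eqxx.
rewrite (exchange_big_dep (mem Fs)) /=; last by move=> y F _ /andP[].
transitivity (\sum_(F in Fs) 2); last by rewrite sum_nat_const mulnC.
apply: eq_bigr => F FFs.
rewrite -(@card_factor_nbrs V e F (F2 F FFs) (fun C => F4 F C FFs) x e_sym) -sum1_card.
by apply: eq_bigl => y; rewrite inE FFs.
Qed.

(** Removing an orbit [{x, f x}] of size two changes neither the parity of the set nor its fixed
    points. *)
Lemma involution_odd (T : finType) (A : {set T}) (f : T -> T) :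
  {in A, forall x, f x \in A} -> {in A, forall x, f (f x) = x} -> odd #|A| ->
  odd #|[set x in A | f x == x]|.
Proof.
have [k] := ubnP #|A|; elim: k A => // k IH A Ak fA fK A_odd.
have [x /andP[xA fx]|none] := pickP (fun x => (x \in A) && (f x != x)); last first.
  have -> : [set x in A | f x == x] = A; last by [].
  apply/setP=> x; rewrite inE; have := none x.
  by case: (x \in A) => //=; case: eqP.
pose B := A :\ x :\ f x.
have cA : #|A| = #|B|.+2.
  by rewrite (cardsD1 x) xA (cardsD1 (f x) (A :\ x)) !inE fx fA.
have -> : [set x in A | f x == x] = [set x in B | f x == x].
  apply/setP=> y; rewrite !inE; have [->|yx] := eqVneq y x.
    by rewrite (negbTE fx) !andbF.
  have [->|yfx] := eqVneq y (f x); last by [].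
  by rewrite fK // eq_sym (negbTE fx) andbF.
apply: IH.
- by move: Ak; rewrite cA ltnS; apply: ltnW.
- move=> y; rewrite !inE => /and3P[yfx yx yA]; rewrite fA // andbT.
  apply/andP; split; first by apply: contraNneq yx => h; rewrite -(fK y) // h fK.
  by apply: contraNneq yfx => h; rewrite -(fK y) // h.
- by move=> y; rewrite !inE => /and3P[_ _ /fK].
- by move: A_odd; rewrite cA /= negbK.
Qed.

(** * Translates of cycles and factors, and their periods *)

Section Shift.

Variable G : finZmodType.
Local Open Scope ring_scope.

Definition shift_cycle (C : {set {set G}}) (g : G) : {set {set G}} :=
  [set [set x + g | x in E] | E : {set G} in C].

Lemma translateE (F : {set {set {set G}}}) (g : G) : translate F g = [set shift_cycle C g | C in F].
Proof. by []. Qed.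

Lemma shift_cycleD C g h : shift_cycle (shift_cycle C g) h = shift_cycle C (g + h).
Proof.
rewrite /shift_cycle -imset_comp; apply: eq_imset => E /=.
by rewrite -imset_comp; apply: eq_imset => x /=; rewrite addrA.
Qed.

Lemma shift_cycle0 C : shift_cycle C 0 = C.
Proof.
rewrite /shift_cycle (eq_imset (g := id)) ?imset_id // => E.
by rewrite (eq_imset (g := id)) ?imset_id // => x; rewrite addr0.
Qed.

Lemma translateD (F : {set {set {set G}}}) (g h : G) :
  translate (translate F g) h = translate F (g + h).
Proof.
rewrite !translateE -imset_comp; apply: eq_imset => C /=.
exact: shift_cycleD.
Qed.

Lemma translate0 (F : {set {set {set G}}}) : translate F 0 = F.
Proof.
rewrite translateE (eq_imset (g := id)) ?imset_id // => C; exact: shift_cycle0.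
Qed.

Lemma cover_shift_cycle C g : cover (shift_cycle C g) = [set x + g | x in cover C].
Proof.
apply/setP=> y; apply/bigcupP/imsetP => [[E /imsetP[E' E'C ->] /imsetP[x xE' ->]]|].
  by exists x => //; apply/bigcupP; exists E'.
case=> x /bigcupP[E EC xE] ->; exists [set x + g | x in E]; last exact: imset_f.
exact: imset_f.
Qed.

(* Sum the elements of [A] and of its translate. *)
Lemma invariant_set_mulrn (A : {set G}) g : [set x + g | x in A] = A -> g *+ #|A| = 0.
Proof.
move=> Ag; have : \sum_(x in A) x = \sum_(x in A) (x + g).
  by rewrite -{1}Ag big_imset //= => x y _ _; apply: addIr.
rewrite big_split sumr_const /= => /eqP.
by rewrite -{1}[X in X == _]addr0 (inj_eq (addrI _)) => /eqP.
Qed.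

(** For the least positive period [s], the first [s] translates are distinct members of [Fs], and a
    nonzero remainder of [N] modulo [s] would be a smaller period. *)
Lemma translate_period (Fs : {set {set {set {set G}}}}) F g N :
  is_cyclic Fs -> F \in Fs -> (0 < N)%N -> g *+ N = 0 -> exists s,
  [/\ (0 < s)%N, (s <= #|Fs|)%N, (s %| N)%N &
     forall k, (s %| k)%N -> translate F (g *+ k) = F].
Proof.
move=> cycFs FFs N0 gN; pose per s := (0 < s)%N && (translate F (g *+ s) == F).
have exper : exists s, per s by exists N; rewrite /per N0 gN translate0 eqxx.
have [s /andP[s0 /eqP Fs_s] smin] := ex_minnP exper.
have step q : translate F (g *+ (q * s)) = F.
  by elim: q => [|q IH]; rewrite ?translate0 // mulSn mulrnDr -translateD Fs_s.
exists s; split=> //; last by move=> k /dvdnP[q ->].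
- have inj : injective (fun i : 'I_s => translate F (g *+ i)).
    suff lt (i j : 'I_s) : (i < j)%N -> translate F (g *+ i) <> translate F (g *+ j).
      move=> i j /= e; have [ij|ij|ij] := ltngtP i j.
      - by case: (lt _ _ ij e).
      - by case: (lt _ _ ij (esym e)).
      - exact: val_inj.
    move=> ij e; have : per (s - j + i)%N.
      rewrite /per addn_gt0 subn_gt0 ltn_ord /= addnC mulrnDr -translateD e translateD.
      by rewrite -mulrnDr subnKC ?Fs_s // ltnW.
    by move/smin; have := ltn_ord j; clear -ij; lia.
  rewrite -[s]card_ord -(card_imset _ inj) subset_leq_card //.
  by apply/subsetP => _ /imsetP[i _ ->]; apply: cycFs.
- apply/negPn/negP; rewrite /dvdn -lt0n => r0.
  have : per (N %% s)%N.
    rewrite /per r0 -{1}(step (N %/ s)%N) translateD -mulrnDr -divn_eq gN.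
    by rewrite translate0 eqxx.
  by move/smin; rewrite leqNgt ltn_pmod.
Qed.

End Shift.

(** * Degrees in the multipartite graph *)

Lemma card_multiples m n : 1 < m * n -> 0 < m ->
  #|[set z : 'Z_(m * n) | m %| val z]| = n.
Proof.
move=> mn1 m0; pose f (i : 'I_n) : 'Z_(m * n) := (m * i)%:R%R.
have fE i : val (f i) = m * i.
  by rewrite /f val_natr // modn_small // ltn_pmul2l.
have f_inj : injective f.
  move=> i j ij; have /eqP := congr1 val ij.
  by rewrite !fE eqn_pmul2l // => /eqP/val_inj.
rewrite -[RHS]card_ord -(card_imset _ f_inj); apply: eq_card => z.
rewrite inE; apply/idP/imsetP => [/dvdnP[k zk]|[i _ ->]]; last by rewrite fE dvdn_mulr.
have kn : k < n by rewrite -(ltn_pmul2r m0) -zk [n * m]mulnC val_ltn.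
by exists (Ordinal kn) => //; apply: val_inj; rewrite fE zk mulnC.
Qed.

Lemma KmnE m n (x y : 'Z_(m * n)) : 1 < m * n ->
  Kmn m n x y = ~~ (m %| val (x - y)%R).
Proof. by move=> mn1; rewrite -mem_part_subgroup. Qed.

Lemma Kmn_sym m n (x y : 'Z_(m * n)) : 1 < m * n -> Kmn m n x y = Kmn m n y x.
Proof.
by move=> mn1; rewrite !KmnE // -(dvdn_val_oppr mn1) ?dvdn_mulr // opprB.
Qed.

Lemma card_Kmn_nbrs m n (x : 'Z_(m * n)) : 1 < m * n -> 0 < m ->
  #|[set y | Kmn m n x y]| = m * n - n.
Proof.
move=> mn1 m0; have cG : #|'Z_(m * n)| = m * n by rewrite card_ord Zp_cast.
suff : #|[set y | Kmn m n x y]| + #|[set z : 'Z_(m * n) | m %| val z]| = #|'Z_(m * n)|.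
  by rewrite card_multiples // cG => h; rewrite -[RHS](congr1 (subn^~ n) h) addnK.
rewrite -(cardC [set y | Kmn m n x y]); congr (_ + _).
have inj : injective (fun z : 'Z_(m * n) => (x - z)%R).
  by move=> y z /addrI/oppr_inj.
rewrite -(card_imset _ inj); apply: eq_card => y; rewrite !inE KmnE // negbK.
apply/imsetP/idP => [[z]|xy]; rewrite ?inE.
  by move=> mz ->; rewrite subKr.
by exists (x - y)%R; rewrite ?inE ?subKr.
Qed.

(** * Parity conditions and translations fixing a factor *)

Section Necessity.

Variables (m n : nat) (Fs : {set {set {set {set 'Z_(m * n)}}}}).
Hypotheses (m_gt1 : 1 < m) (n_gt1 : 1 < n).
Hypothesis Fs_fact : is_cycle_factorization (Kmn m n) 4 Fs.

Let mn1 : 1 < m * n.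
Proof. by apply: leq_trans m_gt1 _; rewrite leq_pmulr // ltnW. Qed.

Let sym (x y : 'Z_(m * n)) : Kmn m n x y = Kmn m n y x.
Proof. exact: Kmn_sym. Qed.

Lemma card_factors : 2 * #|Fs| = m * n - n.
Proof. by rewrite -(card_nbrs 0%R sym Fs_fact) card_Kmn_nbrs // ltnW. Qed.

Lemma card_factor_Kmn F : F \in Fs -> m * n = 4 * #|F|.
Proof.
case: Fs_fact => -[F2 _] F4 FFs.
rewrite -(card_factor (F2 F FFs) (fun C => F4 F C FFs)) card_ord.
by rewrite Zp_cast.
Qed.

Lemma factors_nonempty : exists F, F \in Fs.
Proof.
apply/set0Pn; rewrite -cards_eq0 -lt0n; have := card_factors.
have : n < m * n by rewrite -{1}[n]mul1n ltn_pmul2r // ltnW.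
lia.
Qed.

(** From [m * n = 4 * #|F|], an odd [m] forces [4] to divide [n]; from [2 * #|Fs| = m * n - n], an
    even [m] forces [n] to be even. *)
Lemma parity_cond : (~~ odd m /\ ~~ odd n) \/ (odd m /\ n = 0 %[mod 4]).
Proof.
have [F FFs] := factors_nonempty; have mn4 : 4 %| m * n.
  by rewrite (card_factor_Kmn FFs) dvdn_mulr.
have := card_factors; case: (boolP (odd m)) => m_odd c; [right | left].
  split=> //; apply/eqP; move: mn4; rewrite Gauss_dvdr //.
  by rewrite (@coprime_pexpl 2 2) // coprime2n.
split=> //; have : ~~ odd (m * n - n) by rewrite -c oddM.
rewrite oddB ?leq_pmull ?(ltnW m_gt1) // oddM (negbTE m_odd) /=.
by [].
Qed.

(** The cycle through [{0, x}] and its translate by [x] share the vertex [x], so they coincide. *)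
Lemma stable_edge F x : F \in Fs -> translate F x = F ->
  [set 0%R; x] \in cover F -> (x *+ 4)%R = 0%R.
Proof.
case: Fs_fact => -[F2 _] F4 FFs Fx /bigcupP[C CF xC].
have vC y : y \in [set 0%R; x] -> y \in cover C.
  by move=> yx; apply/bigcupP; exists [set 0%R; x].
have CxF : shift_cycle C x \in F by rewrite -Fx translateE; apply: imset_f.
have Cx : shift_cycle C x = C.
  apply: (factor_cycle_uniq (F2 F FFs) (x := x) CxF CF); last by rewrite vC ?inE ?eqxx ?orbT.
  rewrite cover_shift_cycle; apply/imsetP; exists 0%R; rewrite ?add0r //.
  by rewrite vC ?inE ?eqxx.
rewrite -(card_cover_cycle (F2 F FFs) (fun C => F4 F C FFs) CF).
by apply: invariant_set_mulrn; rewrite -cover_shift_cycle Cx.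
Qed.

(** Four translations by [m] are the identity, so parity is used twice: translation by [2 * m] is an
    involution on the odd number of cycles, and translation by [m] is one on the cycles fixed by
    it. *)
Lemma unstable_order4 F : n = 4 -> odd m -> F \in Fs -> translate F m%:R%R <> F.
Proof.
move=> n4 m_odd FFs Fm; have [[F2 _] F4] := Fs_fact.
have F4' C : C \in F -> #|C| = 4 by apply: F4.
have shF C : C \in F -> shift_cycle C m%:R%R \in F.
  by move=> CF; rewrite -Fm translateE; apply: imset_f.
have sh2 C : shift_cycle C (m%:R + m%:R)%R = shift_cycle (shift_cycle C m%:R%R) m%:R%R.
  by rewrite shift_cycleD.
have m4 : ((m%:R + m%:R) + (m%:R + m%:R))%R = 0%R :> 'Z_(m * n).
  apply: val_inj; rewrite -!natrD val_natr //= -[RHS](modnn (m * n)).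
  by congr (_ %% _); rewrite n4; clear; lia.
have oF : odd #|F|.
  have /eqP : 4 * #|F| = 4 * m by rewrite -(card_factor_Kmn FFs) mulnC n4.
  by rewrite eqn_pmul2l // => /eqP->.
pose F1 := [set C in F | shift_cycle C (m%:R + m%:R)%R == C].
have oF1 : odd #|F1|.
  apply: involution_odd => // C CF; first by rewrite sh2 !shF.
  by rewrite shift_cycleD m4 shift_cycle0.
have : odd #|[set C in F1 | shift_cycle C m%:R%R == C]|.
  apply: involution_odd => // C; rewrite !inE => /andP[CF /eqP C2].
    by rewrite shF // shift_cycleD addrA -shift_cycleD C2 eqxx.
  by rewrite -sh2.
have [->|[C]] := set_0Vmem [set C in F1 | shift_cycle C m%:R%R == C]; first by rewrite cards0.
rewrite !inE => /andP[/andP[CF _] /eqP Cm] _.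
have [a aC] : exists a, a \in cover C.
  by apply/set0Pn; rewrite -cards_eq0 (card_cover_cycle (F2 F FFs) F4' CF).
have [b [c [d [_ /and4P[ab _ _ _] CE]]]] := factor_cycle (F2 F FFs) F4' CF aC.
(* The invariant cycle contains the coset [S], which also has four elements; hence the neighbour [b]
   of [a] would lie in the part of [a]. *)
pose S : {set 'Z_(m * n)} := [set a + (m * i)%:R | i : 'I_4]%R.
have SC : S \subset cover C.
  apply/subsetP => _ /imsetP[[i /= i4] _ ->]; elim: i {i4} => [|i IH].
    by rewrite muln0 addr0.
  rewrite mulnS addnC natrD addrA -Cm cover_shift_cycle.
  exact: imset_f.
have cS : #|S| = 4.
  rewrite card_imset ?card_ord // => i j /addrI ij.
  have vm (k : 'I_4) : val ((m * k)%:R : 'Z_(m * n))%R = m * k.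
    by rewrite val_natr // modn_small // n4 ltn_pmul2l // ltnW.
  have := congr1 val ij; rewrite !vm => /eqP; rewrite eqn_pmul2l ?(ltnW m_gt1) //.
  by move/eqP/val_inj.
have eSC : S = cover C.
  by apply/eqP; rewrite eqEcard SC cS (card_cover_cycle (F2 F FFs) F4' CF).
have : b \in S by rewrite eSC CE cover_quad !inE eqxx ?orbT.
case/imsetP=> i _ be; move: ab; rewrite sym KmnE // be addrC addKr.
by rewrite dvdn_val_natr ?dvdn_mulr.
Qed.

End Necessity.

Lemma no_prime_power p k (Fs : {set {set {set {set 'Z_(p ^ k.+1 * 4)}}}}) :
  prime p -> odd p -> is_cycle_factorization (Kmn (p ^ k.+1) 4) 4 Fs ->
  is_cyclic Fs -> False.
Proof.
move=> p_pr p_odd fact cyc; have p1 := prime_gt1 p_pr.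
have m_gt1 : 1 < p ^ k.+1 by rewrite -{1}(expn0 p) ltn_exp2l.
have mn1 : 1 < p ^ k.+1 * 4 by rewrite (leq_trans m_gt1) // leq_pmulr.
have pk0 : 0 < p ^ k by rewrite expn_gt0 prime_gt0.
have p4 : ~~ (p %| 4).
  rewrite (_ : 4 = 2 ^ 2) // Euclid_dvdX // dvdn_prime2 // andbT.
  by apply: contraTneq p_odd => ->.
have card2 := card_factors m_gt1 (isT : 1 < 4) fact.
have x0_edge : Kmn (p ^ k.+1) 4 0%R (4 * p ^ k)%:R%R.
  have mN : p ^ k.+1 %| p ^ k.+1 * 4 by rewrite dvdn_mulr.
  rewrite KmnE // add0r (dvdn_val_oppr mn1 mN) (dvdn_val_natr mn1 mN).
  by rewrite expnS dvdn_pmul2r.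
have [F FFs xF] : exists2 F, F \in Fs & [set 0%R; (4 * p ^ k)%:R%R] \in cover F.
  have : [set 0%R; (4 * p ^ k)%:R%R] \in edges (Kmn (p ^ k.+1) 4).
    rewrite inE; apply/existsP; exists 0%R; apply/existsP; exists (4 * p ^ k)%:R%R.
    by rewrite x0_edge eqxx.
  case: fact => -[_ E1] _ /E1/eqP/cards1P[F hF].
  by exists F; have := set11 F; rewrite -hF inE => /andP[].
have N0 : (1 *+ (p ^ k.+1 * 4) = 0 :> 'Z_(p ^ k.+1 * 4))%R.
  by apply: val_inj; rewrite val_natr // modnn.
have [s [s0 sFs sN per]] := translate_period cyc FFs (ltnW mn1) N0.
have [g [gk sg]] : exists j, j <= k.+1 /\ gcdn s (p ^ k.+1) = p ^ j.
  by have /(dvdn_pfactor _ _ p_pr)[j] := dvdn_gcdr s (p ^ k.+1); exists j.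
(* If [p ^ k.+1] does not divide the period [s], then [s] divides [4 * p ^ k], so [F] is fixed by
   [x], and [4 * x = 0] would make [p] divide 4. *)
have [gk'|gk'] := leqP g k.
  have s4 : s %| 4 * p ^ k.
    apply: (@dvdn_trans (4 * p ^ g)); last by rewrite dvdn_pmul2l // dvdn_exp2l.
    by rewrite -sg muln_gcdr dvdn_gcd dvdn_mull // mulnC.
  have := stable_edge fact FFs (per _ s4) xF.
  rewrite -mulrnA => /(congr1 val); rewrite val_natr //= => /eqP.
  rewrite -/(dvdn _ _) expnS => h; have : p * (p ^ k * 4) %| 4 * (p ^ k * 4).
    by rewrite mulnA (_ : 4 * _ = 4 * p ^ k * 4) // mulnA.
  by rewrite dvdn_pmul2r ?muln_gt0 ?pk0 // (negbTE p4).
have {gk gk'} gk : g = k.+1 by apply/eqP; rewrite eqn_leq gk.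
have ps : p ^ k.+1 %| s by rewrite -gk -sg dvdn_gcdl.
(* A multiple of [p ^ k.+1] that is at most [#|Fs| = 2 * p ^ k.+1 - 2]. *)
have sm : s = p ^ k.+1.
  case/dvdnP: ps s0 sFs => -[|[|q]] ->; rewrite ?mul1n // => _ h.
  have : 2 * p ^ k.+1 <= q.+2 * p ^ k.+1 by rewrite leq_mul2r orbT.
  by move: card2 h m_gt1; move: #|Fs| (q.+2 * _) => c d; move: (p ^ k.+1) => m; clear; lia.
apply: (unstable_order4 m_gt1 (isT : 1 < 4) fact erefl _ FFs (per _ _)); last by rewrite sm.
by rewrite oddX.
Qed.

Lemma necessity m n (hm : 1 < m) (hn : 1 < n)
    (Fs : {set {set {set {set 'Z_(m * n)}}}}) :
  is_cycle_factorization (Kmn m n) 4 Fs -> is_cyclic Fs ->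
  (~~ odd m /\ ~~ odd n) \/
  [/\ odd m, n = 0 %[mod 4] &
      ~ (exists p a : nat, [/\ prime p, 1 <= a & (m, n) = (p ^ a, 4)])].
Proof.
move=> fact cyc; case: (parity_cond hm hn fact) => [|[m_odd n4]]; [by left | right].
split=> // -[p [[|k] [p_pr // _ [mE nE]]]]; subst m n.
apply: (no_prime_power p_pr _ fact cyc).
by move: m_odd; rewrite oddX.
Qed.

Theorem theorem1p1 (m n : nat) (hm : 1 < m) (hn : 1 < n) :
  (exists Fs : {set {set {set {set 'Z_(m * n)}}}},
     is_cycle_factorization (Kmn m n) 4 Fs /\ is_cyclic Fs)
  <->
  (~~ odd m /\ ~~ odd n) \/
  [/\ odd m, n = 0 %[mod 4] &
      ~ (exists p a : nat, [/\ prime p, 1 <= a & (m, n) = (p ^ a, 4)])].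
Proof.
split=> [[Fs [fact cyc]]|]; first exact: necessity fact cyc.
exact: sufficiency.
Qed.
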